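(* Let $X$ be an almost-continuous diffusion. Choose any increasing function $g:\mathbb{R}\to\mathbb{R}$ and $T\in\mathbb{R}_+$ such that $\mathbb{E}[|g(X_T)|]<\infty$. Then, for every $t\in[0,T]$ there exists an increasing function $f:\mathbb{R}\to\mathbb{R}\cup\{\pm\infty\}$ such that $f(X_t)=\mathbb{E}[g(X_T)\mid\mathcal{F}_t]$ almost surely.
   Context: All processes are indexed by $t\in\mathbb{R}_+=[0,\infty)$ and are defined with respect to (and adapted to) a filtered probability space $(\Omega,\mathcal{F},(\mathcal{F}_t)_{t\in\mathbb{R}_+},\mathbb{P})$. ''Increasing'' means non-decreasing. Strong Markov: a real valued process $X$ is strong Markov if for every bounded measurable $g:\mathbb{R}\to\mathbb{R}$ and every $t\in\mathbb{R}_+$ there exists a measurable $f:\mathbb{R}_+\times\mathbb{R}\to\mathbb{R}$ such that $f(\tau,X_\tau)=\mathbb{E}[g(X_{\tau+t})\mid\mathcal{F}_\tau]$ (a.s.) for every finite stopping time $\tau$. Almost-continuous: a real valued process $X$ is almost-continuous if it is cadlag, continuous in probability, and given any two independent, identically distributed cadlag processes $Y,Z$ with the same distribution as $X$, for every $s<t$ in $\mathbb{R}_+$, $$\mathbb{P}\left(Y_s<Z_s,\ Y_t>Z_t \text{ and } Y_u\neq Z_u \text{ for every } u\in(s,t)\right)=0.$$ An almost-continuous diffusion is a process that is both strong Markov and almost-continuous. *)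

(* Defs.v *)
From HB Require Import structures.
From mathcomp Require Import all_boot all_order all_algebra.
From mathcomp Require Import all_classical all_reals all_analysis.
Import Order.TTheory GRing.Theory Num.Theory.
Import numFieldNormedType.Exports.

Set Implicit Arguments.
Unset Strict Implicit.
Unset Printing Implicit Defensive.

Local Open Scope classical_set_scope.
Local Open Scope ring_scope.

(* Time is R_+.  A process is a function X : R -> Omega -> R, of which only the
   values X t at times 0 <= t are ever used.  Likewise, a path is a function
   R -> R of which only the restriction to R_+ matters. *)

Definition filtration d (Omega : measurableType d) (R : realType)
    (F : R -> set (set Omega)) : Prop :=
  (forall t : R, 0 <= t -> sigma_algebra setT (F t) /\ F t `<=` measurable) /\
  (forall s t : R, 0 <= s -> s <= t -> F s `<=` F t).

Definition adapted d (Omega : measurableType d) (R : realType)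
    (F : R -> set (set Omega)) (X : R -> Omega -> R) : Prop :=
  forall t : R, 0 <= t -> forall B : set R, measurable B -> F t (X t @^-1` B).

(* Finite stopping times. *)
Definition stopping_time d (Omega : measurableType d) (R : realType)
    (F : R -> set (set Omega)) (tau : Omega -> R) : Prop :=
  (forall w, 0 <= tau w) /\
  (forall t : R, 0 <= t -> F t [set w | tau w <= t]).

Definition stopped_sigma d (Omega : measurableType d) (R : realType)
    (F : R -> set (set Omega)) (tau : Omega -> R) : set (set Omega) :=
  [set A | measurable A /\
    forall t : R, 0 <= t -> F t (A `&` [set w | tau w <= t])].

Definition cond_exp_version d (Omega : measurableType d) (R : realType)
    (P : probability Omega R) (G : set (set Omega)) (Y W : Omega -> R) : Prop :=
  [/\ P.-integrable setT (EFin \o Y),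
      forall B : set R, measurable B -> G (W @^-1` B),
      P.-integrable setT (EFin \o W) &
      forall A, G A ->
        (\int[P]_(w in A) (W w)%:E = \int[P]_(w in A) (Y w)%:E)%E].

(* V = E[Y | G] almost surely; V may take infinite values on a null set. *)
Definition ae_eq_cond_exp d (Omega : measurableType d) (R : realType)
    (P : probability Omega R) (G : set (set Omega)) (Y : Omega -> R)
    (V : Omega -> \bar R) : Prop :=
  exists W : Omega -> R, cond_exp_version P G Y W /\
    {ae P, forall w, V w = (W w)%:E}.

Definition strong_markov d (Omega : measurableType d) (R : realType)
    (P : probability Omega R) (F : R -> set (set Omega))
    (X : R -> Omega -> R) : Prop :=
  forall g : R -> R, measurable_fun setT g -> bounded_fun g ->
  forall t : R, 0 <= t ->
  exists f : R * R -> R,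
    measurable_fun ([set s : R | 0 <= s] `*` [set: R] : set (R * R)) f /\
    forall tau : Omega -> R, stopping_time F tau ->
      ae_eq_cond_exp P (stopped_sigma F tau)
        (fun w => g (X (tau w + t) w))
        (fun w => (f (tau w, X (tau w) w))%:E).

Definition random_process d (Omega : measurableType d) (R : realType)
    (X : R -> Omega -> R) : Prop :=
  forall t : R, 0 <= t -> measurable_fun setT (X t).

Definition cadlag_path (R : realType) (x : R -> R) : Prop :=
  (forall t : R, 0 <= t -> x s @[s --> t^'+] --> x t) /\
  (forall t : R, 0 < t -> cvg (x s @[s --> t^'-])).

Definition cadlag d (Omega : measurableType d) (R : realType)
    (X : R -> Omega -> R) : Prop :=
  forall w, cadlag_path (X ^~ w).

Definition continuous_in_probability d (Omega : measurableType d)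
    (R : realType) (P : probability Omega R) (X : R -> Omega -> R) : Prop :=
  forall t : R, 0 <= t -> forall eps : R, 0 < eps ->
    P [set w | eps < `|X s w - X t w|]
      @[s --> within [set s : R | 0 <= s] (nbhs t)] --> 0%E.

(* The product sigma-algebra on path space, generated by the coordinate maps
   x |-> x t for t in R_+. *)
Definition path_sigma (R : realType) : set (set (R -> R)) :=
  <<s \bigcup_(t in [set t : R | 0 <= t])
        preimage_set_system setT (fun x : R -> R => x t) measurable >>.

Definition path_event d (Omega : measurableType d) (R : realType)
    (X : R -> Omega -> R) (A : set (R -> R)) : set Omega :=
  [set w | A (X ^~ w)].

Definition same_law d d' (Omega : measurableType d) (Omega' : measurableType d')
    (R : realType) (P : probability Omega R) (P' : probability Omega' R)
    (X : R -> Omega -> R) (Y : R -> Omega' -> R) : Prop :=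
  forall A, path_sigma A -> P (path_event X A) = P' (path_event Y A).

Definition independent_processes d (Omega : measurableType d) (R : realType)
    (P : probability Omega R) (Y Z : R -> Omega -> R) : Prop :=
  forall A B, path_sigma A -> path_sigma B ->
    P (path_event Y A `&` path_event Z B)
    = (P (path_event Y A) * P (path_event Z B))%E.

(* The crossing event involves uncountably many times and need not belong to
   the sigma-algebra of Omega'; that it has probability zero is understood in
   the completion of P', that is, as negligibility. *)
Definition almost_continuous d (Omega : measurableType d) (R : realType)
    (P : probability Omega R) (X : R -> Omega -> R) : Prop :=
  [/\ cadlag X,
      continuous_in_probability P X &
      forall d' (Omega' : measurableType d') (P' : probability Omega' R)
        (Y Z : R -> Omega' -> R),
        random_process Y -> random_process Z -> cadlag Y -> cadlag Z ->
        independent_processes P' Y Z ->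
        same_law P P' X Y -> same_law P P' X Z ->
        forall s t : R, 0 <= s -> s < t ->
          P'.-negligible [set w | [/\ Y s w < Z s w, Z t w < Y t w &
            forall u : R, s < u -> u < t -> Y u w <> Z u w]]].

Definition almost_continuous_diffusion d (Omega : measurableType d)
    (R : realType) (P : probability Omega R) (F : R -> set (set Omega))
    (X : R -> Omega -> R) : Prop :=
  strong_markov P F X /\ almost_continuous P X.

(* Main.v *)
Require Import Defs.
From HB Require Import structures.
From mathcomp Require Import all_boot all_order all_algebra.
From mathcomp Require Import all_classical all_reals all_analysis.
From mathcomp Require Import measurable_realfun ring.
Import Order.TTheory GRing.Theory Num.Theory.
Import numFieldNormedType.Exports.

(** The proof couples two independent copies of the process.  By the Markov
property E[g(X_T) | F_t] = phi(X_t) for some Borel function phi, and phi agrees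
almost surely with an increasing function as soon as two independent copies of
X_t are almost surely not inverted by phi: on the product of Omega with itself,
with the product probability, the event
  B = { X_t(w1) < X_t(w2), phi(X_t(w2)) < phi(X_t(w1)) }
has to be null.  For this it is enough that
  E[1_B g(X_T(w1))] <= E[1_B g(X_T(w2))]
for every event B of time t on which X_t(w1) < X_t(w2), because the two sides
are also the integrals over B of phi(X_t(w1)) and phi(X_t(w2)).

The inequality comes from watching the two copies from time t on, until a time
sigma <= T before which X(w1) < X(w2).  Almost-continuity forbids that the
copies exchange their order without meeting, so that X_sigma(w1) <=
X_sigma(w2) almost surely.  If sigma can be chosen such that equality holds
whenever sigma < T, then there are two cases: where sigma = T the order has been
kept up to T and g, being increasing, preserves it; where sigma < T both copies
restart from the same point at the same time, and by the strong Markov property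
X_T(w1) and X_T(w2) have the same conditional law.

Two points need care.
- The natural choice of sigma is the first meeting time, but for a filtration
  that is neither right-continuous nor complete this may fail to be a stopping
  time.  The first time at which the distance X(w2) - X(w1) has come arbitrarily
  close to 0 is a stopping time, but at a jump the copies may come arbitrarily
  close without meeting.  So sigma is taken of maximal expectation among the
  stopping times before which X(w1) < X(w2)
  ([exists_maximal_pre_crossing]): if the copies were still in strict order at
  sigma < T, waiting for the next such approach would give a larger one.
- The strong Markov property speaks of a fixed lag after sigma, and not of the
  fixed time T.  Rounding the random lag T - sigma up to a grid reaches a time
  slightly after T, and right-continuity gives the limit, at first for
  continuous functions of X_T only ([terminal_law]).  Approximating indicators
  of up-sets, and then comparing tails, recovers all monotone functions
  ([coupled_comparison_nondecreasing]).

Finally [increasing_version] turns the absence of inversions into an increasing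
function that is almost surely equal to phi. *)

Set Implicit Arguments.
Unset Strict Implicit.
Unset Printing Implicit Defensive.

Local Open Scope classical_set_scope.
Local Open Scope ring_scope.

(** * Grids, right-continuity and random times *)

Section Tick.
Context {R : realType}.
Implicit Types (x a : R) (n : nat).

(** Rounding up to the grid of mesh [1 / n.+1], strictly: points of the grid are
moved to the next one, so that [tick n x] approaches [x] from the right. *)
Definition tick n x : R := (Num.truncn (n.+1%:R * x)).+1%:R / n.+1%:R.

Lemma tick_gt n x : 0 <= x -> x < tick n x.
Proof.
move=> x0; have h : 0 <= n.+1%:R * x by rewrite mulr_ge0.
have /andP[_] := truncn_itv h.
by rewrite /tick ltr_pdivlMr// mulrC.
Qed.

Lemma tick_le n x : 0 <= x -> tick n x <= x + n.+1%:R^-1.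
Proof.
move=> x0; have h : 0 <= n.+1%:R * x by rewrite mulr_ge0.
have /andP[+ _] := truncn_itv h.
by rewrite /tick ler_pdivrMr// mulrDl mulVf// (mulrC x) -[X in _ -> X <= _]natr1 lerD2r.
Qed.

Lemma cvg_tick x : 0 <= x -> tick n x @[n --> \oo] --> x.
Proof.
move=> x0.
apply: (@squeeze_cvgr _ _ _ _ (fun=> x) (fun n => x + n.+1%:R^-1)).
- by near=> n; rewrite tick_le// andbT ltW// tick_gt.
- exact: cvg_cst.
- rewrite -[X in _ --> X]addr0; apply: cvgD; [exact: cvg_cst|].
  exact: cvg_harmonic.
Unshelve. all: by end_near. Qed.

Lemma right_cvg_lt (x : R -> R) a c : x s @[s --> a^'+] --> x a -> x a < c ->
  exists2 b, a < b & forall s, a <= s -> s < b -> x s < c.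
Proof.
move=> xa ac.
have [e /= e0 he] := cvgr_lt (x a) xa _ ac.
exists (a + e) => [|s]; first by rewrite ltrDl.
rewrite le_eqVlt => /predU1P[<-//|as_ sae].
apply: he => //=; rewrite ltr0_norm ?subr_lt0// opprB.
by rewrite ltrBlDl.
Qed.

Lemma right_cvg_gt (x : R -> R) a c : x s @[s --> a^'+] --> x a -> c < x a ->
  exists2 b, a < b & forall s, a <= s -> s < b -> c < x s.
Proof.
move=> xa ca; have xa' : - x s @[s --> a^'+] --> - x a by exact: cvgN.
have [|b ab hb] := @right_cvg_lt (- x)%R a (- c) xa'; first by rewrite ltrN2.
by exists b => // s as_ sb; rewrite -ltrN2; exact: hb.
Qed.

(** Evaluation at [tick n (tau w)] takes only countably many times into account,
and right-continuity passes the measurability to the limit. *)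
Lemma measurable_random_time d (S : measurableType d) (Z : R -> S -> R)
    (tau : S -> R) :
  (forall s, 0 <= s -> measurable_fun setT (Z s)) ->
  (forall w s, 0 <= s -> Z u w @[u --> s^'+] --> Z s w) ->
  measurable_fun setT tau -> (forall w, 0 <= tau w) ->
  measurable_fun setT (fun w => Z (tau w) w).
Proof.
move=> mZ Zr mtau tau0.
apply: (@measurable_fun_cvg _ _ _ _ (fun n w => Z (tick n (tau w)) w)).
- move=> n; pose E k := [set w | k%:R <= n.+1%:R * tau w < k.+1%:R].
  have mE k : measurable (E k).
    rewrite (_ : E k = (fun w => n.+1%:R * tau w) @^-1` `[k%:R, k.+1%:R[).
      rewrite -[X in measurable X]setTI; apply: measurable_funM => //.
    by apply/seteqP; split => w /=; rewrite in_itv.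
  have -> : [set: S] = \bigcup_k E k.
    apply/seteqP; split => // w _; exists (Num.truncn (n.+1%:R * tau w)) => //=.
    by apply: truncn_itv; rewrite mulr_ge0.
  apply/measurable_fun_bigcup => // k.
  apply: (eq_measurable_fun (Z (k.+1%:R / n.+1%:R))).
    move=> w /set_mem/= /truncn_def kE.
    by rewrite /tick kE.
  by apply: measurable_funS (mZ _ _) => //; rewrite divr_ge0.
- move=> w _; have /cvg_at_rightP := Zr w _ (tau0 w); apply; split.
    by move=> n; exact: tick_gt.
  exact: cvg_tick.
Qed.

End Tick.

Lemma measurable_ltset {R : realType} d (S : measurableType d) (f g : S -> R) :
  measurable_fun setT f -> measurable_fun setT g ->
  measurable [set w | f w < g w].
Proof.
move=> mf mg; rewrite (_ : [set _ | _] = (fun w => g w - f w) @^-1` `]0, +oo[).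
  rewrite -[X in measurable X]setTI; exact: (measurable_funB mg mf).
by apply/seteqP; split => w /=; rewrite in_itv/= andbT subr_gt0.
Qed.

(** * Sigma-algebras, filtrations and stopping times *)

Section SigmaAlgebra.
Context d (T : measurableType d) (G : set (set T)).
Hypothesis sG : sigma_algebra setT G.

Let measurableE (A : set T) : @measurable _ (g_sigma_algebraType G) A = G A.
Proof. by rewrite /measurable/= sigma_algebra_id. Qed.

Lemma sigma_algebra_setT : G setT.
Proof. by rewrite -[G _]measurableE. Qed.

Lemma sigma_algebra_setC A : G A -> G (~` A).
Proof.
by rewrite -[G A]measurableE -[G (~` _)]measurableE; exact: measurableC.
Qed.

Lemma sigma_algebra_setI A B : G A -> G B -> G (A `&` B).
Proof.
rewrite -[G A]measurableE -[G B]measurableE -[G (_ `&` _)]measurableE.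
exact: measurableI.
Qed.

Lemma sigma_algebra_setU A B : G A -> G B -> G (A `|` B).
Proof.
rewrite -[G A]measurableE -[G B]measurableE -[G (_ `|` _)]measurableE.
exact: measurableU.
Qed.

Lemma sigma_algebra_setD A B : G A -> G B -> G (A `\` B).
Proof.
by move=> GA GB; rewrite setDE; apply: sigma_algebra_setI (sigma_algebra_setC _).
Qed.

Lemma sigma_algebra_bigcup (I : countType) (A : I -> set T) :
  (forall i, G (A i)) -> G (\bigcup_i A i).
Proof.
move=> GA; rewrite -[G _]measurableE; apply: countable_bigcupT_measurable => //.
by move=> i; rewrite measurableE.
Qed.

Lemma sigma_algebra_bigcap (I : countType) (A : I -> set T) :
  (forall i, G (A i)) -> G (\bigcap_i A i).
Proof.
move=> GA; rewrite -[\bigcap_i A i]setCK setC_bigcap.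
by apply: sigma_algebra_setC; apply: sigma_algebra_bigcup => i; exact: sigma_algebra_setC.
Qed.

End SigmaAlgebra.

Section Stopping.
Context {R : realType} d (S : measurableType d).
Variable F : R -> set (set S).
Hypothesis hF : filtration F.

Lemma filtration_sigma t : 0 <= t -> sigma_algebra setT (F t).
Proof. by move=> t0; case: hF => h _; case: (h t t0). Qed.

Lemma filtration_measurable t : 0 <= t -> F t `<=` measurable.
Proof. by move=> t0; case: hF => h _; case: (h t t0). Qed.

Lemma filtration_le s t : 0 <= s -> s <= t -> F s `<=` F t.
Proof. by case: hF => _; exact. Qed.

Lemma cst_stopping_time t : 0 <= t -> stopping_time F (fun=> t).
Proof.
move=> t0; split => // s s0; have sF := filtration_sigma s0.
have [ts|st] := boolP (t <= s).
  rewrite (_ : [set _ | _] = setT); first exact: (sigma_algebra_setT sF).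
  by apply/seteqP; split.
rewrite (_ : [set _ | _] = set0); first by case: sF.
by apply/seteqP; split.
Qed.

Variables (tau : S -> R) (htau : stopping_time F tau).

Lemma stopping_time_measurable : measurable_fun setT tau.
Proof.
apply: (measurability _ (RGenOInfty.measurableE R)).
move=> _ [_ [a ->] <-]; rewrite setTI.
have -> : tau @^-1` `]a, +oo[ = ~` [set w | tau w <= a].
  by apply/seteqP; split => w /=; rewrite in_itv/= andbT ltNge => /negP.
apply: measurableC; have [a0|a0] := leP 0 a.
  by apply: (filtration_measurable a0); case: htau => _; exact.
rewrite (_ : [set _ | _] = set0)//; apply/seteqP; split => // w /= wa.
have [t0 _] := htau; by have := le_lt_trans (le_trans (t0 w) wa) a0; rewrite ltxx.
Qed.

Lemma stopped_sigma_sigma_algebra : sigma_algebra setT (stopped_sigma F tau).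
Proof.
have [t0 tF] := htau; split.
- split => // t ht; rewrite set0I.
  by case: (filtration_sigma ht).
- move=> A [mA AF]; rewrite setTD; split; first exact: measurableC.
  move=> t ht; have sF := filtration_sigma ht.
  rewrite (_ : _ `&` _ = [set w | tau w <= t] `\` (A `&` [set w | tau w <= t])).
    by apply: sigma_algebra_setD => //; [exact: tF|exact: AF].
  rewrite setDIr setDv setU0; by rewrite setDE setIC.
- move=> A hA; split; first by apply: bigcup_measurable => k _; case: (hA k).
  move=> t ht; have sF := filtration_sigma ht.
  rewrite setI_bigcupl; apply: sigma_algebra_bigcup => // k.
  by case: (hA k) => _; exact.
Qed.

Lemma stopped_sigma_le a : stopped_sigma F tau [set w | tau w <= a].
Proof.
have [t0 tF] := htau; split.
  rewrite (_ : [set _ | _] = tau @^-1` `]-oo, a]).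
    by rewrite -[X in measurable X]setTI; exact: stopping_time_measurable.
  by apply/seteqP; split => w /=; rewrite in_itv.
move=> t ht.
have -> : [set w | tau w <= a] `&` [set w | tau w <= t] =
    [set w | tau w <= Num.min a t].
  by apply/seteqP; split => w /=; rewrite le_min => /andP.
have [a0|a0] := leP 0 a.
  have m0 : 0 <= Num.min a t by rewrite le_min a0.
  by apply: (filtration_le m0); [rewrite ge_min lexx orbT|exact: tF].
rewrite (_ : [set _ | _] = set0); first by case: (filtration_sigma ht).
apply/seteqP; split => // w /=; rewrite le_min => /andP[wa _].
by have := le_lt_trans (le_trans (t0 w) wa) a0; rewrite ltxx.
Qed.

Lemma stopped_sigma_itv A a b : stopped_sigma F tau A ->
  stopped_sigma F tau (A `&` [set w | a < tau w <= b]).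
Proof.
move=> hA; have sG := stopped_sigma_sigma_algebra.
have -> : [set w | a < tau w <= b] = [set w | tau w <= b] `\` [set w | tau w <= a].
  apply/seteqP; split => w /=.
    by move=> /andP[h1 ->]; split => //; apply/negP; rewrite -ltNge.
  by move=> [-> /negP]; rewrite -ltNge => ->.
apply: sigma_algebra_setI => //; apply: sigma_algebra_setD => //;
  exact: stopped_sigma_le.
Qed.

Lemma stopped_sigma_lt A b : stopped_sigma F tau A ->
  stopped_sigma F tau (A `&` [set w | tau w < b]).
Proof.
move=> hA; have sG := stopped_sigma_sigma_algebra.
have -> : [set w | tau w < b] = \bigcup_n [set w | tau w <= b - n.+1%:R^-1].
  apply/seteqP; split => w /=.
    rewrite -subr_gt0 => h.
    have [n _ hn] := near_infty_natSinv_lt (PosNum h).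
    exists n => //=; have /= := hn n (leqnn n).
    by move=> hn'; rewrite lerBrDl -lerBrDr ltW.
  by move=> [n _ /=] h; rewrite (le_lt_trans h)// ltrBlDr ltrDl.
apply: sigma_algebra_setI => //; apply: sigma_algebra_bigcup => // n.
exact: stopped_sigma_le.
Qed.

Lemma stopped_sigma_ge A t : 0 <= t -> (forall w, t <= tau w) -> F t A ->
  stopped_sigma F tau A.
Proof.
move=> t0 ttau tA; split; first exact: (filtration_measurable t0).
move=> s s0; have sF := filtration_sigma s0; have [ts|st] := leP t s.
  apply: sigma_algebra_setI => //; first exact: (filtration_le t0 ts).
  exact: htau.2.
rewrite (_ : _ `&` _ = set0); first by case: sF.
apply/seteqP; split => // w [_] /= h.
by have := lt_le_trans st (le_trans (ttau w) h); rewrite ltxx.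
Qed.

End Stopping.

Section ProductFiltration.
Context {R : realType} d (S : measurableType d).
Implicit Type F : R -> set (set S).

(** The filtration of a pair of independent copies.  Only the sections of an
event are asked to belong to [F s]: freezing one of the two copies then gives
stopping times of [F] for the other, which is all that Tonelli's theorem needs
to transfer the strong Markov property to the pair. *)
Definition section_filtration F (s : R) : set (set (S * S)) :=
  [set A | [/\ measurable A, forall y, F s [set x | A (x, y)] &
    forall x, F s [set y | A (x, y)]]].

Lemma section_filtrationP F : filtration F -> filtration (section_filtration F).
Proof.
move=> hF; split; last first.
  move=> s t s0 st A [mA A1 A2]; split => // z; apply: (filtration_le hF s0 st).
    exact: A1.
  exact: A2.
move=> t t0; have sF := filtration_sigma hF t0.
split; last by move=> A [].
have [sF0 sFC sFU] := sF; split.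
- by split => // z; rewrite (_ : [set _ | _] = set0).
- move=> A [mA A1 A2]; rewrite setTD; split; first exact: measurableC.
    by move=> y; exact: (sigma_algebra_setC sF (A1 y)).
  by move=> x; exact: (sigma_algebra_setC sF (A2 x)).
- move=> A hA; split; first by apply: bigcup_measurable => k _; case: (hA k).
    move=> y; rewrite (_ : [set _ | _] = \bigcup_k [set x | A k (x, y)]).
      by apply: sFU => k; case: (hA k).
    by apply/seteqP; split => x [k ? ?]; exists k.
  move=> x; rewrite (_ : [set _ | _] = \bigcup_k [set y | A k (x, y)]).
    by apply: sFU => k; case: (hA k).
  by apply/seteqP; split => y [k ? ?]; exists k.
Qed.

Variables (F : R -> set (set S)) (hF : filtration F).

Lemma section_stopping sig : stopping_time (section_filtration F) sig ->
  (forall y, stopping_time F (fun x => sig (x, y))) /\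
  (forall x, stopping_time F (fun y => sig (x, y))).
Proof.
move=> [sig0 sigF]; split=> z; split => // t t0.
  by have [_ + _] := sigF t t0; exact.
by have [_ _] := sigF t t0; exact.
Qed.

Lemma section_stopped_sigma sig A :
  stopped_sigma (section_filtration F) sig A ->
  (forall y, stopped_sigma F (fun x => sig (x, y)) [set x | A (x, y)]) /\
  (forall x, stopped_sigma F (fun y => sig (x, y)) [set y | A (x, y)]).
Proof.
move=> [mA AF]; split => z; split.
- rewrite (_ : [set x | _] = ysection A z); first exact: measurable_ysection.
  by apply/seteqP; split => x /=; rewrite /ysection/= inE.
- by move=> t t0; have [_ + _] := AF t t0; exact.
- rewrite (_ : [set x | _] = xsection A z); first exact: measurable_xsection.
  by apply/seteqP; split => x /=; rewrite /xsection/= inE.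
- by move=> t t0; have [_ _] := AF t t0; exact.
Qed.

Lemma section_filtration_adapted X s (B : set (R * R)) : adapted F X ->
  0 <= s -> measurable B ->
  section_filtration F s [set w | B (X s w.1, X s w.2)].
Proof.
move=> aX s0 mB.
have mX : measurable_fun setT (X s).
  by move=> _ C mC; rewrite setTI; exact/(filtration_measurable hF s0)/aX.
split.
- have m12 : measurable_fun setT (fun w : S * S => (X s w.1, X s w.2)).
    by apply: measurable_fun_pair; apply: measurableT_comp.
  by rewrite -[X in measurable X]setTI; exact: m12.
- move=> y; have := aX s s0 _ (measurable_ysection (X s y) mB).
  congr (F s _); apply/seteqP; split => x /=; by rewrite /ysection/= inE.
- move=> x; have := aX s s0 _ (measurable_xsection (X s x) mB).
  congr (F s _); apply/seteqP; split => y /=; by rewrite /xsection/= inE.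
Qed.

End ProductFiltration.

(** * A maximal stopping time before a crossing *)

Section MaximalStopping.
Context {R : realType} d (S : measurableType d).
Variables (P : probability S R) (F : R -> set (set S)) (D : R -> S -> R).
Hypotheses (hF : filtration F)
  (aD : forall (s c : R), 0 <= s -> F s [set w | D s w < c])
  (Dr : forall w (s : R), 0 <= s -> D u w @[u --> s^'+] --> D s w).
Variables (t T : R).
Hypotheses (t0 : 0 <= t) (tT : t <= T).

(** The infimum of [D] over the times between [sig w] and [s] is at most 0.  At a
jump of [D] this can happen while [D] itself stays positive; in exchange, by
right-continuity, it is decided by the values of [D] at [s] and at rational times
before [s]. *)
Definition touched (sig : S -> R) (s : R) : set S :=
  [set w | forall n, exists q, [/\ sig w <= q, q <= s & D q w < n.+1%:R^-1]].

Lemma touched_mono sig s s' w : s <= s' -> touched sig s w -> touched sig s' w.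
Proof.
move=> ss' h n; have [q [h1 h2 h3]] := h n.
by exists q; split => //; exact: le_trans ss'.
Qed.

(** If [D] has stayed above some positive level up to time [s], then by
right-continuity it stays above a smaller one for a little longer. *)
Lemma touched_right_closed sig s w : 0 <= sig w ->
  (forall s', s < s' -> touched sig s' w) -> touched sig s w.
Proof.
move=> sig0 h; apply: contrapT => /existsNP[n hn].
have hn' q : sig w <= q -> q <= s -> n.+1%:R^-1 <= D q w.
  by move=> h1 h2; rewrite leNgt; apply/negP => h3; apply: hn; exists q.
have [sigs|ssig] := leP (sig w) s; last first.
  have [q [h1 h2 _]] := h _ (midf_lt ssig).1 0%N.
  by have := le_lt_trans (le_trans h1 h2) (midf_lt ssig).2; rewrite ltxx.
have n12 : n.+2%:R^-1 < n.+1%:R^-1 :> R by rewrite ltf_pV2 ?posrE// ltr_nat.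
have [b sb hb] := right_cvg_gt (@Dr w s (le_trans sig0 sigs))
  (lt_le_trans n12 (hn' _ sigs (lexx s))).
have [q [h1 h2 h3]] := h _ (midf_lt sb).1 n.+1.
have [qs|sq] := leP q s.
  by have := lt_trans (le_lt_trans (hn' _ h1 qs) h3) n12; rewrite ltxx.
have := hb q (ltW sq) (le_lt_trans h2 (midf_lt sb).2).
by rewrite ltNge (ltW h3).
Qed.

Lemma touched_adapted sig s : stopping_time F sig -> 0 <= s -> F s (touched sig s).
Proof.
move=> [sig0 sigF] s0; have sF := filtration_sigma hF s0.
pose A n (q : R) := [set w | sig w <= q] `&` [set w | D q w < n.+1%:R^-1].
have FA n q : 0 <= q <= s -> F s (A n q).
  move=> /andP[q0 qs]; apply: (filtration_le hF q0 qs).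
  apply: sigma_algebra_setI; [exact: filtration_sigma|exact: sigF|exact: aD].
have -> : touched sig s = \bigcap_n (A n s `|` \bigcup_(q : rat)
    (if 0 <= (ratr q : R) <= s then A n (ratr q) else set0)).
  apply/seteqP; split => w /=.
    move=> h n _; have [q [h1 h2 h3]] := h n.
    move: h2; rewrite le_eqVlt => /predU1P[qs|qs]; first by left; rewrite -qs.
    right; have q0 := le_trans (sig0 w) h1.
    have [b qb hb] := right_cvg_lt (@Dr w q q0) h3.
    have qsb : q < Num.min s b by rewrite lt_min qs.
    have [r] := rat_in_itvoo qsb; rewrite in_itv/= lt_min => /and3P[qr rs rb].
    exists r => //; rewrite (le_trans q0 (ltW qr)) (ltW rs)/=; split => /=.
      exact: le_trans (ltW qr).
    by apply: hb => //; exact: ltW.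
  move=> h n; have [[/= h1 h2]|[q _]] := h n I; first by exists s.
  by case: ifPn => // /andP[q0 qs] [/= h1 h2]; exists (ratr q).
apply: sigma_algebra_bigcap => // n; apply: sigma_algebra_setU => //.
  by apply: FA; rewrite s0 lexx.
apply: sigma_algebra_bigcup => // q; case: ifPn => [|_]; first exact: FA.
by case: sF.
Qed.

Definition touching_time (sig : S -> R) (w : S) : R :=
  inf [set s | s <= T /\ (s = T \/ touched sig s w)].

Definition pre_crossing (sig : S -> R) := [/\ stopping_time F sig,
  forall w, t <= sig w <= T & forall w u, t <= u -> u < sig w -> 0 < D u w].

Section Touching.
Variable (sig : S -> R).
Hypothesis hsig : pre_crossing sig.

Let E w := [set s | s <= T /\ (s = T \/ touched sig s w)].

Let E_lb w : lbound (E w) (sig w).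
Proof.
have [_ sigT _] := hsig.
move=> s [sT [->|h]]; first by case/andP: (sigT w).
by have [q [h1 h2 _]] := h 0%N; exact: le_trans h2.
Qed.

Let E_T w : E w T. Proof. by split => //; left. Qed.

Let has_infE w : has_inf (E w).
Proof. by split; [exists T; exact: E_T|exists (sig w); exact: E_lb]. Qed.

Lemma touching_time_ge w : sig w <= touching_time sig w.
Proof. by apply: lb_le_inf; [exists T; exact: E_T|exact: E_lb]. Qed.

Lemma touching_time_leT w : touching_time sig w <= T.
Proof. by apply: ge_inf; [exists (sig w); exact: E_lb|exact: E_T]. Qed.

(** Right-closedness makes the infimum that defines the touching time attained;
this is what makes it a stopping time of a filtration that need not be
right-continuous. *)
Lemma touching_time_le w s : s < T -> (touching_time sig w <= s) = `[< touched sig s w >].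
Proof.
have [[sig0 _] _ _] := hsig.
move=> sT; apply/idP/asboolP => [h|h]; last first.
  by apply: ge_inf; [exists (sig w); exact: E_lb|split; [exact: ltW|right]].
apply: touched_right_closed => // s' ss'.
have hs : touching_time sig w < Num.min s' T by rewrite lt_min !(le_lt_trans h).
have [e Ee] := inf_lt (has_infE w).1 hs.
rewrite lt_min => /andP[es' eT]; case: Ee => _ [eeT|he].
  by rewrite eeT ltxx in eT.
exact: touched_mono (ltW es') he.
Qed.

Lemma touching_time_pre_crossing : pre_crossing (touching_time sig).
Proof.
have [hs sigT sigD] := hsig; split.
- split => [w|s s0].
    by apply: le_trans (touching_time_ge w); case: hs => + _; exact.
  have sF := filtration_sigma hF s0.
  have [Ts|sT] := leP T s.
    rewrite (_ : [set _ | _] = setT); first exact: (sigma_algebra_setT sF).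
    by apply/seteqP; split => // w _ /=; exact: le_trans (touching_time_leT w) Ts.
  rewrite (_ : [set _ | _] = touched sig s); first exact: touched_adapted.
  by apply/seteqP; split => w /=; rewrite touching_time_le// => /asboolP.
- move=> w; rewrite touching_time_leT andbT.
  by apply: le_trans (touching_time_ge w); case/andP: (sigT w).
- move=> w u tu us; have [usig|sigu] := ltP u (sig w); first exact: sigD.
  have uT := lt_le_trans us (touching_time_leT w).
  rewrite ltNge; apply/negP => Du; move: us; rewrite ltNge => /negP; apply.
  rewrite touching_time_le//; apply/asboolP => n; exists u; split => //.
  by apply: le_lt_trans Du _; rewrite invr_gt0.
Qed.

(** By right-continuity [D] stays away from 0 right after [sig]. *)
Lemma touching_time_gt w : sig w < T -> 0 < D (sig w) w ->
  sig w < touching_time sig w.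
Proof.
have [[sig0 _] _ _] := hsig.
move=> sT; set c := D _ _ => c0; rewrite ltNge touching_time_le//.
apply/asboolP => h; pose n := Num.truncn c^-1.
have [q [h1 h2]] := h n.
have -> : q = sig w by apply/eqP; rewrite eq_le h1 h2.
rewrite -/c ltNge => /negP; apply; rewrite invf_ple ?posrE//.
by rewrite ltW// truncnS_gt.
Qed.

End Touching.

(** The stopping times in question are stable under countable suprema, so their
expectations, which are at most [T], attain a maximum at some [sig].  The touching
time after [sig] is again one of them and is later than [sig] wherever [D] is
still positive before [T]; by maximality this happens on a null set only. *)
Lemma exists_maximal_pre_crossing : exists2 sig, pre_crossing sig &
  P.-negligible [set w | sig w < T /\ 0 < D (sig w) w].
Proof.
have T0 := le_trans t0 tT.
pose m (sig : S -> R) := (\int[P]_w (sig w)%:E)%E.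
pose M := ereal_sup [set m sig | sig in pre_crossing].
have ge0 sig w : pre_crossing sig -> 0 <= sig w.
  by move=> [_ /(_ w)/andP[+ _] _]; exact: le_trans.
have mpc sig : pre_crossing sig -> measurable_fun setT (EFin \o sig).
  by move=> [hs _ _]; apply/measurable_EFinP; exact: (stopping_time_measurable hF hs).
have mT sig : pre_crossing sig -> (0 <= m sig <= T%:E)%E.
  move=> hs; apply/andP; split; first by apply: integral_ge0 => w _; rewrite lee_fin ge0.
  have -> : T%:E = (\int[P]_w (cst T%:E w))%E.
    by rewrite integral_cst//= probability_setT mule1.
  apply: ge0_le_integral => //.
  - by move=> w _; rewrite lee_fin ge0.
  - exact: mpc.
  - by move=> w _; rewrite lee_fin; case: hs => _ /(_ w)/andP[].
have hconst : pre_crossing (fun=> t).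
  split => [|w|w u tu ut]; [exact: cst_stopping_time|by rewrite lexx tT|].
  by have := le_lt_trans tu ut; rewrite ltxx.
have Mle sig : pre_crossing sig -> (m sig <= M)%E.
  by move=> hs; apply: ereal_sup_ubound; exists sig.
have Mfin : M \is a fin_num.
  rewrite ge0_fin_numE.
    apply: le_lt_trans (ltry T); apply: ge_ereal_sup => _ [sig hs <-].
    by case/andP: (mT _ hs).
  by apply: le_trans (Mle _ hconst); case/andP: (mT _ hconst).
have /choice[sn hsn] : forall n, exists sig, pre_crossing sig /\
    (M - n.+1%:R^-1%:E < m sig)%E.
  move=> n; have [|_ [sig hs <-] h] := ub_ereal_sup_adherent (e := n.+1%:R^-1) _ Mfin.
    by rewrite invr_gt0.
  by exists sig.
pose sig w := sup (range (fun n => sn n w)).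
have snT n w : t <= sn n w <= T by have [[]] := hsn n.
have hub w : has_ubound (range (fun n => sn n w)).
  by exists T => _ [n _ <-]; case/andP: (snT n w).
have sn_le n w : sn n w <= sig w by apply: ub_le_sup => //; exists n.
have nonempty w : range (fun n => sn n w) !=set0 by exists (sn 0%N w), 0%N.
have hsig : pre_crossing sig.
  split; last 1 first.
  - move=> w u tu /(sup_gt (nonempty w))[_ [n _ <-] us].
    by have [[_ _ +] _] := hsn n; apply.
  - split => [w|s s0].
      by apply: le_trans (sn_le 0%N w); have [+ _] := hsn 0%N; exact: ge0.
    have sF := filtration_sigma hF s0.
    have -> : [set w | sig w <= s] = \bigcap_n [set w | sn n w <= s].
      apply/seteqP; split => w /=; first by move=> h n _; exact: le_trans h.
      by move=> h; apply: ge_sup => // _ [n _ <-]; exact: h.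
    by apply: sigma_algebra_bigcap => // n; have [[[_ +] _ _] _] := hsn n; exact.
  - move=> w; apply/andP; split.
      by apply: le_trans (sn_le 0%N w); case/andP: (snT 0%N w).
    by apply: ge_sup => // _ [n _ <-]; case/andP: (snT n w).
have msig : m sig = M.
  apply/eqP; rewrite eq_le Mle//=; apply/lee_subgt0Pr => e e0.
  have [n _ /(_ n (leqnn n)) hn] := near_infty_natSinv_lt (PosNum e0).
  apply: le_trans (_ : m (sn n) <= _)%E.
    apply: ltW; apply: le_lt_trans (hsn n).2; rewrite leeB// lee_fin ltW//.
  apply: ge0_le_integral => //.
  - by move=> w _; rewrite lee_fin ge0//; case: (hsn n).
  - by apply: mpc; case: (hsn n).
  - exact: mpc.
  - by move=> w _; rewrite lee_fin.
have hext := touching_time_pre_crossing hsig; set ext := touching_time sig in hext.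
have mext : measurable_fun setT (fun w => (ext w - sig w)%:E).
  apply/measurable_EFinP/measurable_funB; apply/measurable_EFinP; exact: mpc.
have ext0 w : 0 <= ext w - sig w by rewrite subr_ge0 touching_time_ge.
have int0 : (\int[P]_w (ext w - sig w)%:E)%E = 0%E.
  have : (m ext = m sig + \int[P]_w (ext w - sig w)%:E)%E.
    rewrite -ge0_integralD//.
    - by apply: eq_integral => w _; rewrite -EFinD addrC subrK.
    - by move=> w _; rewrite lee_fin ge0.
    - exact: mpc.
    - by move=> w _; rewrite lee_fin.
  move=> hm; apply/eqP; rewrite eq_le; apply/andP; split; last first.
    by apply: integral_ge0 => w _; rewrite lee_fin.
  have := Mle _ hext; rewrite hm msig -[leRHS]adde0 leeD2lE//.
have /(ae_eq_integral_abs P measurableT mext).1 : (\int[P]_w `|(ext w - sig w)%:E|)%E = 0%E.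
  by rewrite -[RHS]int0; apply: eq_integral => w _; rewrite gee0_abs// lee_fin.
move=> a; exists sig => //; apply: negligibleS a => w /= [sT Ds] h; have [e] := h I.
by have := touching_time_gt hsig sT Ds; rewrite -/ext -subr_gt0 e ltxx.
Qed.

End MaximalStopping.

(** * The strong Markov property for a pair of copies *)

Section Tonelli.
Context {R : realType} d (S : measurableType d) (P : probability S R).

Lemma tonelli_sections (C : set (S * S)) (h : S * S -> \bar R) :
  measurable C -> measurable_fun setT h -> (forall w, 0 <= h w)%E ->
  (\int[P \x P]_(w in C) h w =
     \int[P]_y \int[P]_(x in [set x | C (x, y)]) h (x, y))%E /\
  (\int[P \x P]_(w in C) h w =
     \int[P]_x \int[P]_(y in [set y | C (x, y)]) h (x, y))%E.
Proof.
move=> mC mh h0.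
have mhC : measurable_fun setT (h \_ C).
  by apply/(measurable_restrictT h mC); exact: measurable_funTS.
have hC0 w : (0 <= (h \_ C) w)%E by rewrite patchE; case: ifP.
split; rewrite integral_mkcond.
  rewrite fubini_tonelli2//; apply: eq_integral => y _.
  rewrite /fubini_G [RHS]integral_mkcond; apply: eq_integral => x _.
  by rewrite !patchE /=; congr (if _ then _ else _); apply/idP/idP => /set_mem ?; exact/mem_set.
rewrite fubini_tonelli1//; apply: eq_integral => x _.
rewrite /fubini_F [RHS]integral_mkcond; apply: eq_integral => y _.
by rewrite !patchE /=; congr (if _ then _ else _); apply/idP/idP => /set_mem ?; exact/mem_set.
Qed.

End Tonelli.

Section ConditionalExpectation.
Context {R : realType} d (S : measurableType d) (P : probability S R).

(** The event that the conditional expectation is negative belongs to the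
conditioning sigma-algebra, and its integral over this event is nonnegative. *)
Lemma cond_exp_ge0 G (Y W : S -> R) : G `<=` measurable ->
  cond_exp_version P G Y W -> (forall w, 0 <= Y w) -> {ae P, forall w, 0 <= W w}.
Proof.
move=> Gm [iY WG iW WY] Y0.
pose D := W @^-1` `]-oo, 0[; have GD : G D by exact: WG.
have mD := Gm _ GD.
have iWD : P.-integrable D (EFin \o W) by exact: integrableS iW.
have mW := measurable_int _ iWD.
have : (\int[P]_(w in D) `|(W w)%:E|)%E = 0%E.
  have -> : (\int[P]_(w in D) `|(W w)%:E|)%E = (\int[P]_(w in D) - (W w)%:E)%E.
    apply: eq_integral => w /set_mem; rewrite /D/= in_itv/= => Wn.
    by rewrite /abse ltr0_norm.
  apply/eqP; rewrite eq_le; apply/andP; split; last first.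
    apply: integral_ge0 => w; rewrite /D/= in_itv/= => Wn.
    by rewrite lee_fin oppr_ge0 ltW.
  have -> : (\int[P]_(w in D) - (W w)%:E)%E = (- \int[P]_(w in D) (W w)%:E)%E.
    by rewrite (@integralN _ _ _ P D (EFin \o W))//; apply: integrable_add_def.
  by rewrite leeNl oppe0 WY//; apply: integral_ge0 => w _; rewrite lee_fin.
move=> /(ae_eq_integral_abs P mD mW).1; apply: filterS => w /= h.
rewrite leNgt; apply/negP => Wn; have : D w by rewrite /D/= in_itv.
by move=> /h[W0]; rewrite W0 ltxx in Wn.
Qed.

End ConditionalExpectation.

Section Markov.
Context {R : realType} d (S : measurableType d) (P : probability S R).
Variables (F : R -> set (set S)) (X : R -> S -> R).
Hypotheses (hF : filtration F) (aX : adapted F X) (smX : strong_markov P F X)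
  (cX : cadlag X).

Lemma adapted_random_process : random_process X.
Proof.
move=> s s0 _ B mB; rewrite setTI; exact/(filtration_measurable hF s0)/aX.
Qed.

Lemma measurable_stopped d' (S' : measurableType d') (p : S' -> S) (tau : S' -> R) :
  measurable_fun setT p -> measurable_fun setT tau -> (forall w, 0 <= tau w) ->
  measurable_fun setT (fun w => X (tau w) (p w)).
Proof.
move=> mp mtau tau0.
apply: (measurable_random_time (Z := fun s w => X s (p w))) => //.
  by move=> s s0; apply: measurableT_comp => //; exact: adapted_random_process.
by move=> w s s0; have [+ _] := cX (p w); exact.
Qed.

Local Notation H := ([set s : R | 0 <= s] `*` [set: R] : set (R * R)).

Lemma measurable_halfplane : measurable H.
Proof.
apply: measurableX => //; rewrite (_ : [set s | 0 <= s] = `[0, +oo[%classic)//.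
by apply/seteqP; split => s /=; rewrite in_itv/= andbT.
Qed.

Lemma measurable_halfplane_comp d' (S' : measurableType d') (f : R * R -> R)
    (tau Z : S' -> R) : measurable_fun H f -> (forall w, 0 <= tau w) ->
  measurable_fun setT tau -> measurable_fun setT Z ->
  measurable_fun setT (fun w => f (tau w, Z w)).
Proof.
move=> mf tau0 mtau mZ.
apply: (measurable_comp (F := H) _ _ mf).
- exact: measurable_halfplane.
- by move=> _ [w _ <-]; split => //=; exact: tau0.
- exact: measurable_fun_pair.
Qed.

(** Replacing the function of the strong Markov property by its positive part
changes it on a null set only, and leaves nonnegative functions, to which
Tonelli's theorem applies without integrability conditions. *)
Lemma strong_markov_ge0 (g : R -> R) (u : R) : measurable_fun setT g ->
  bounded_fun g -> (forall x, 0 <= g x) -> 0 <= u ->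
  exists f : R * R -> R, [/\ measurable_fun H f, forall z, 0 <= f z &
    forall tau, stopping_time F tau -> forall A, stopped_sigma F tau A ->
    (\int[P]_(w in A) (g (X (tau w + u) w))%:E =
     \int[P]_(w in A) (f (tau w, X (tau w) w))%:E)%E].
Proof.
move=> mg bg g0 u0; have [f [mf hf]] := smX mg bg u0.
have mf' : measurable_fun H (fun z => Num.max (f z) 0) by exact: measurable_maxr.
exists (fun z => Num.max (f z) 0); split => //.
  by move=> z; rewrite le_max lexx orbT.
move=> tau htau A FA; have [W [hW fW]] := hf _ htau.
have FAm : stopped_sigma F tau `<=` measurable by move=> ? [].
have mA := FAm _ FA.
have W0 := cond_exp_ge0 FAm hW (fun w => g0 _).
have [_ _ iW <-//] := hW.
have mtau := stopping_time_measurable hF htau.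
have mXt : measurable_fun setT (fun w => X (tau w) w).
  by apply: (measurable_stopped (p := id)) => //; case: htau.
apply: ae_eq_integral => //.
- by apply: measurable_funTS; exact: measurable_int iW.
- apply/measurable_EFinP; apply: measurable_funTS.
  apply: (measurable_halfplane_comp mf') => //; by case: htau.
- move: W0 fW; apply: filterS2 => w W0 [fW] _; rewrite fW.
  by congr (_%:E); apply/esym/max_idPl.
Qed.

(** The same function [f] serves for both coordinates: this is what makes two
copies that meet indistinguishable in law afterwards. *)
Lemma product_strong_markov (g : R -> R) (u : R) : measurable_fun setT g ->
  bounded_fun g -> (forall x, 0 <= g x) -> 0 <= u ->
  exists2 f : R * R -> R, measurable_fun H f &
    forall sig C, stopping_time (section_filtration F) sig ->
    stopped_sigma (section_filtration F) sig C ->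
  (\int[P \x P]_(w in C) (g (X (sig w + u) w.1))%:E =
     \int[P \x P]_(w in C) (f (sig w, X (sig w) w.1))%:E)%E /\
  (\int[P \x P]_(w in C) (g (X (sig w + u) w.2))%:E =
     \int[P \x P]_(w in C) (f (sig w, X (sig w) w.2))%:E)%E.
Proof.
move=> mg bg g0 u0; have [f [mf f0 hf]] := strong_markov_ge0 mg bg g0 u0.
exists f => // sig C hsig hC.
have [s1 s2] := section_stopping hsig.
have [C1 C2] := section_stopped_sigma hC.
have mC : measurable C by case: hC.
have msig := stopping_time_measurable (section_filtrationP hF) hsig.
have sig0 w : 0 <= sig w by case: hsig.
have mg' (p : S * S -> S) : measurable_fun setT p ->
    measurable_fun setT (fun w => (g (X (sig w + u) (p w)))%:E).
  move=> mp; apply/measurable_EFinP; apply: measurableT_comp => //.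
  apply: (measurable_stopped (tau := fun w => sig w + u)) => //.
    exact: measurable_funD.
  by move=> w; rewrite addr_ge0.
have mf' (p : S * S -> S) : measurable_fun setT p ->
    measurable_fun setT (fun w => (f (sig w, X (sig w) (p w)))%:E).
  move=> mp; apply/measurable_EFinP; apply: (measurable_halfplane_comp mf) => //.
  exact: measurable_stopped.
split.
  rewrite (tonelli_sections P mC (mg' _ _) _).1//; last by move=> w; rewrite lee_fin.
  rewrite (tonelli_sections P mC (mf' _ _) _).1//; last by move=> w; rewrite lee_fin.
  apply: eq_integral => y _ /=.
  by rewrite (hf (fun x => sig (x, y))).
rewrite (tonelli_sections P mC (mg' _ _) _).2//; last by move=> w; rewrite lee_fin.
rewrite (tonelli_sections P mC (mf' _ _) _).2//; last by move=> w; rewrite lee_fin.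
apply: eq_integral => x _ /=.
by rewrite (hf (fun y => sig (x, y))).
Qed.

End Markov.

(** * Copies do not cross without meeting *)

Section IndependentCopies.
Context {R : realType} d (S : measurableType d) (P : probability S R).
Variable (X : R -> S -> R).
Hypothesis rX : random_process X.

Lemma measurable_path_event A : path_sigma A -> measurable (path_event X A).
Proof.
suff : path_sigma (R := R) `<=` [set A | measurable (path_event X A)] by exact.
apply: smallest_sub.
  split => [|B mB|B mB] /=.
  - exact: measurable0.
  - by rewrite setTD; exact: (measurableC mB).
  - rewrite (_ : path_event X _ = \bigcup_k path_event X (B k)).
      by apply: bigcup_measurable => k _; exact: mB.
    by apply/seteqP; split => w [k ? ?]; exists k.
move=> _ [s /= s0 [B mB <-]]; rewrite setTI /path_event/=.
by rewrite -[X in measurable X]setTI; exact: rX.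
Qed.

Let X1 s (w : S * S) := X s w.1.
Let X2 s (w : S * S) := X s w.2.

Let event1 A : path_event X1 A = path_event X A `*` setT.
Proof. by apply/seteqP; split => [[x y] h|[x y] []]. Qed.

Let event2 A : path_event X2 A = setT `*` path_event X A.
Proof. by apply/seteqP; split => [[x y] h|[x y] []]. Qed.


Let law1 A : path_sigma A -> (P \x P)%E (path_event X1 A) = P (path_event X A).
Proof.
move=> /measurable_path_event mA.
by rewrite event1 product_measure1E//= probability_setT mule1.
Qed.

Let law2 A : path_sigma A -> (P \x P)%E (path_event X2 A) = P (path_event X A).
Proof.
move=> /measurable_path_event mA.
by rewrite event2 product_measure1E//= probability_setT mul1e.
Qed.

Lemma crossing_negligible s t : almost_continuous P X -> 0 <= s -> s < t ->
  (P \x P)%E.-negligible [set w : S * S | [/\ X s w.1 < X s w.2,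
    X t w.2 < X t w.1 & forall u, s < u -> u < t -> X u w.1 <> X u w.2]].
Proof.
move=> [cX _ acX] s0 st.
apply: (acX _ _ (P \x P)%E X1 X2) => //.
- move=> u u0; apply: (measurableT_comp (rX u0)); exact: measurable_fst.
- move=> u u0; apply: (measurableT_comp (rX u0)); exact: measurable_snd.
- by move=> w; exact: (cX w.1).
- by move=> w; exact: (cX w.2).
- move=> A B hA hB.
  rewrite [RHS](_ : _ = P (path_event X A) * P (path_event X B))%E; last first.
    by congr (_ * _)%E; [exact: law1|exact: law2].
  rewrite event1 event2.
  rewrite -setXI setTI setIT.
  by apply: product_measure1E; exact: measurable_path_event.
- by move=> A hA; apply/esym; exact: law1.
- by move=> A hA; apply/esym; exact: law2.
Qed.

(** If the order were reversed at [sig], then by right-continuity it would be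
reversed up to some rational time [q], with strict order in one direction before
[sig] and in the other between [sig] and [q]; so the copies would have crossed
between [t] and [q] without meeting.  There are countably many such [q]. *)
Lemma ordered_at_crossing (t : R) (sig : S * S -> R) : almost_continuous P X ->
  0 <= t -> (forall w, t <= sig w) ->
  (forall w u, t <= u -> u < sig w -> X u w.1 < X u w.2) ->
  (P \x P)%E.-negligible
    [set w : S * S | X t w.1 < X t w.2 /\ X (sig w) w.2 < X (sig w) w.1].
Proof.
move=> acX t0 tsig hsig; have [cX _ _] := acX.
pose N (q : rat) := [set w : S * S | t < ratr q /\ [/\ X t w.1 < X t w.2,
    X (ratr q) w.2 < X (ratr q) w.1 &
    forall u, t < u -> u < ratr q -> X u w.1 <> X u w.2]].
have hN q : (P \x P)%E.-negligible (N q).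
  have [tq|tq] := boolP (t < ratr q).
    by apply: negligibleS (crossing_negligible acX t0 tq) => w [].
  rewrite (_ : N q = set0); first exact: negligible_set0.
  by apply/seteqP; split => // w []; rewrite (negbTE tq).
pose N' n := if unpickle n is Some q then N q else set0.
apply: (negligibleS (A := \bigcup_n N' n)); last first.
  apply: negligible_bigcup => n; rewrite /N'; case: unpickle => [q|] //.
  exact: negligible_set0.
move=> w [lt_t gt_sig].
have s0 : 0 <= sig w := le_trans t0 (tsig w).
pose D u := X u w.1 - X u w.2.
have Dr : D u @[u --> (sig w)^'+] --> D (sig w).
  by apply: cvgB; [have [+ _] := cX w.1|have [+ _] := cX w.2]; exact.
have [|b sb hb] := right_cvg_gt Dr (c := 0); first by rewrite subr_gt0.
have [q] := rat_in_itvoo sb; rewrite in_itv/= => /andP[sq qb].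
exists (pickle q); first exact: I.
rewrite /N' pickleK.
split; first exact: le_lt_trans sq.
split => //.
  by rewrite -subr_gt0; apply: hb => //; exact: ltW.
move=> u tu uq; have [us|su] := ltP u (sig w).
  by apply/eqP; rewrite lt_eqF// hsig// ltW.
apply/eqP; rewrite gt_eqF// -subr_gt0; apply: hb => //; exact: lt_trans qb.
Qed.

End IndependentCopies.

(** * Comparison of two copies at the terminal time *)

Section Comparison.
Context {R : realType} d (S : measurableType d) (P : probability S R).
Variables (F : R -> set (set S)) (X : R -> S -> R).
Hypotheses (hF : filtration F) (aX : adapted F X) (smX : strong_markov P F X)
  (acX : almost_continuous P X).
Local Notation G := (section_filtration F).
Let cX : cadlag X. Proof. by case: acX. Qed.

Section TerminalLaw.
Variables (T : R) (k : R -> R) (sig : S * S -> R) (C : set (S * S)).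
Hypotheses (ck : continuous k) (k01 : forall x, 0 <= k x <= 1)
  (hsig : stopping_time G sig) (sigT : forall w, sig w <= T)
  (hC : stopped_sigma G sig C).

Let mC : measurable C. Proof. by case: hC. Qed.
Let msig : measurable_fun setT sig.
Proof. exact: (stopping_time_measurable (section_filtrationP hF) hsig). Qed.
Let sig0 w : 0 <= sig w. Proof. by case: hsig. Qed.
Let mk : measurable_fun setT k. Proof. exact: continuous_measurable_fun. Qed.

(* The lag [T - sig w] is rounded up, so [rho n w] tends to [T] from the right;
   on [E n j] the rounded lag is the constant [j.+1 / n.+1]. *)
Let rho n w := sig w + tick n (T - sig w).

Let rho_gt n w : T < rho n w.
Proof. by rewrite -ltrBlDl tick_gt// subr_ge0. Qed.

Let T0 (w : S * S) : 0 <= T. Proof. exact: le_trans (sigT w). Qed.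

Let E n j := C `&` [set w | T - j.+1%:R / n.+1%:R < sig w <= T - j%:R / n.+1%:R].

Let hE n j : stopped_sigma G sig (E n j).
Proof. exact: (stopped_sigma_itv (section_filtrationP hF) hsig). Qed.

Let tickE n j w : E n j w -> tick n (T - sig w) = j.+1%:R / n.+1%:R.
Proof.
move=> [_ /= /andP[h1 h2]]; rewrite /tick; congr (_.+1%:R / _).
apply: truncn_def; rewrite mulrC -ler_pdivrMr// -ltr_pdivlMr//.
by rewrite lerBrDr -lerBrDl h2/= ltrBlDr -ltrBlDl.
Qed.

Let E_cover n : C = \bigcup_j E n j.
Proof.
apply/seteqP; split => [w Cw|w [j _ []]//].
have h : 0 <= n.+1%:R * (T - sig w) by rewrite mulr_ge0// subr_ge0.
exists (Num.truncn (n.+1%:R * (T - sig w))) => //; split => //=.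
have /andP[] := truncn_itv h.
rewrite mulrC -ler_pdivrMr// -ltr_pdivlMr// => h1 h2.
by rewrite ltrBlDr -ltrBlDl h2/= lerBrDr -lerBrDl.
Qed.

Let E_triv n : trivIset setT (E n).
Proof.
move=> i j _ _ [w [Ei Ej]]; have := tickE Ei; rewrite (tickE Ej).
have n0 : n.+1%:R^-1 != 0 :> R by rewrite invr_neq0.
by move=> /(mulIf n0)/eqP; rewrite eqr_nat => /eqP[].
Qed.

Let mrho n : measurable_fun setT (rho n).
Proof.
apply: measurable_funD => //; rewrite /tick.
apply: measurable_funM => //.
rewrite (_ : (fun _ => _) = (fun r : R => (Num.truncn r).+1%:R) \o
  (fun w => n.+1%:R * (T - sig w)))//.
apply: measurableT_comp.
  apply: nondecreasing_measurable => // x y xy.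
  by rewrite ler_nat ltnS le_truncn.
by apply: measurable_funM => //; exact: measurable_funB.
Qed.

Let rho0 n w : 0 <= rho n w.
Proof. exact: le_trans (T0 w) (ltW (rho_gt n w)). Qed.

Let mkX (p : S * S -> S) (tau : S * S -> R) : measurable_fun setT p ->
  measurable_fun setT tau -> (forall w, 0 <= tau w) ->
  measurable_fun setT (fun w => (k (X (tau w) (p w)))%:E).
Proof.
move=> mp mtau tau0; apply/measurable_EFinP; apply: measurableT_comp => //.
exact: (measurable_stopped hF aX).
Qed.

Let cvg_terminal (p : S * S -> S) : measurable_fun setT p ->
  (\int[P \x P]_(w in C) (k (X (rho n w) (p w)))%:E)%E @[n --> \oo] -->
  (\int[P \x P]_(w in C) (k (X T (p w)))%:E)%E.
Proof.
move=> mp; apply: (@dominated_cvg _ _ _ _ C mC _ _ (cst 1%E)) => //.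
- by move=> n; apply: measurable_funTS; exact: mkX.
- move=> w _; apply: cvg_EFin; first by near=> n.
  apply: (@continuous_cvg _ _ _ _ _ (fun n => X (rho n w) (p w)) k _ (@ck _)).
  have /cvg_at_rightP := (cX (p w)).1 T (T0 w); apply; split.
    by move=> n; exact: rho_gt.
  rewrite -[X in _ --> X](subrK (sig w)) addrC.
  by apply: cvgD; [exact: cvg_cst|apply: cvg_tick; rewrite subr_ge0].
- exact: (@finite_measure_integrable_cst _ _ R ((P \x P)%E : probability _ R) C 1 mC).
- move=> n w _; have /andP[k0 k1] := k01 (X (rho n w) (p w)).
  by rewrite /= lee_fin ger0_norm.
Unshelve. all: by end_near. Qed.

(** On each piece [E n j] the strong Markov property applies with a constant lag
and gives integrals of the same function of the time and of the common position
of the copies.  Summing over [j] gives the equality at the times [rho n], and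
[n] tending to infinity gives it at [T]. *)
Lemma terminal_law :
  (P \x P)%E.-negligible [set w | C w /\ X (sig w) w.1 <> X (sig w) w.2] ->
  (\int[P \x P]_(w in C) (k (X T w.1))%:E =
   \int[P \x P]_(w in C) (k (X T w.2))%:E)%E.
Proof.
move=> neq0.
suff rhoE n : (\int[P \x P]_(w in C) (k (X (rho n w) w.1))%:E =
               \int[P \x P]_(w in C) (k (X (rho n w) w.2))%:E)%E.
  have c1 := cvg_terminal (@measurable_fst _ _ _ _).
  have c2 := cvg_terminal (@measurable_snd _ _ _ _).
  move: c2; rewrite -(funext rhoE) => c2; exact: (cvg_unique _ c1 c2).
have splitE (p : S * S -> S) : measurable_fun setT p ->
    (\int[P \x P]_(w in C) (k (X (rho n w) (p w)))%:E =
     \sum_(0 <= j <oo) \int[P \x P]_(w in E n j)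
        (k (X (sig w + j.+1%:R / n.+1%:R) (p w)))%:E)%E.
  move=> mp; rewrite {1}(E_cover n) ge0_integral_bigcup//.
  - apply: eq_eseriesr => j _; apply: eq_integral => w /set_mem Ew.
    by rewrite /rho (tickE Ew).
  - by move=> j; case: (hE n j).
  - by apply: measurable_funTS; exact: mkX.
  - by move=> w _; rewrite lee_fin; case/andP: (k01 (X (rho n w) (p w))).
rewrite !splitE; [|exact: measurable_snd|exact: measurable_fst].
apply: eq_eseriesr => j _.
have bk : bounded_fun k.
  exists 1; split => // M M1 x _ /=.
  by have /andP[k0 k1] := k01 x; rewrite ger0_norm// (le_trans k1)// ltW.
have u0 : 0 <= j.+1%:R / n.+1%:R :> R by rewrite divr_ge0.
have k0 x : 0 <= k x by case/andP: (k01 x).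
have [f mf hf] := product_strong_markov hF aX smX cX mk bk k0 u0.
have [-> ->] := hf _ _ hsig (hE n j).
have mfX (p : S * S -> S) : measurable_fun setT p ->
    measurable_fun (E n j) (fun w => (f (sig w, X (sig w) (p w)))%:E).
  move=> mp; apply: measurable_funTS; apply/measurable_EFinP.
  apply: (measurable_halfplane_comp mf) => //.
  exact: (measurable_stopped hF aX).
apply: ae_eq_integral.
- by have [] := hE n j.
- by apply: mfX; exact: measurable_fst.
- by apply: mfX; exact: measurable_snd.
- apply: negligibleS neq0 => w /= /not_implyP[[Cw _] h]; split => //.
  by move=> e; apply: h; rewrite e.
Qed.

End TerminalLaw.

(** The event [B] is split according to whether the maximal stopping time [sig]
is before [T].  Where it is, the copies are at the same point at time [sig] and
[terminal_law] gives an equality; where [sig = T], the copies are still in order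
at time [T]. *)
Lemma coupled_comparison_continuous (k : R -> R) (t T : R) (B : set (S * S)) :
  continuous k -> (forall x, 0 <= k x <= 1) -> {homo k : x y / x <= y} ->
  0 <= t -> t <= T -> G t B -> B `<=` [set w | X t w.1 < X t w.2] ->
  (\int[P \x P]_(w in B) (k (X T w.1))%:E <=
   \int[P \x P]_(w in B) (k (X T w.2))%:E)%E.
Proof.
move=> ck k01 hk t0 tT GB BX; have T0 := le_trans t0 tT.
have hG := section_filtrationP hF.
pose D s (w : S * S) := X s w.2 - X s w.1.
have aD s c : 0 <= s -> G s [set w | D s w < c].
  move=> s0; pose B' := [set z : R * R | z.2 - z.1 < c].
  apply: (@section_filtration_adapted _ _ _ _ hF X s B') => //.
  rewrite /B' (_ : [set _ | _] = (fun z : R * R => z.2 - z.1) @^-1` `]-oo, c[).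
    rewrite -[X in measurable X]setTI.
    exact: measurable_funB.
  by apply/seteqP; split => z /=; rewrite in_itv.
have Dr w s : 0 <= s -> D u w @[u --> s^'+] --> D s w.
  move=> s0; apply: cvgB; [exact: (cX w.2).1|exact: (cX w.1).1].
have [sig [hsig sigT sigD] sig_max] :=
  exists_maximal_pre_crossing (P \x P : probability _ R)%E hG aD Dr t0 tT.
have sig_t w : t <= sig w by case/andP: (sigT w).
have sig_T w : sig w <= T by case/andP: (sigT w).
have := @ordered_at_crossing _ _ _ P X (adapted_random_process hF aX) t sig acX
  t0 sig_t.
have sigX w u : t <= u -> u < sig w -> X u w.1 < X u w.2.
  by move=> tu us; rewrite -subr_gt0; exact: sigD.
move=> /(_ sigX) sig_le.
pose C := B `&` [set w | sig w < T].
have hB : stopped_sigma G sig B by exact: stopped_sigma_ge sig_t GB.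
have hC : stopped_sigma G sig C by exact: stopped_sigma_lt.
have mB : measurable B by case: hB.
have mC : measurable C by case: hC.
have mBC : measurable (B `\` C) by exact: measurableD.
have mk : measurable_fun setT k by exact: continuous_measurable_fun.
have mkX (A : set (S * S)) (p : S * S -> S) : measurable_fun setT p ->
    measurable_fun A (fun w => (k (X T (p w)))%:E).
  move=> mp; apply: measurable_funTS; apply/measurable_EFinP.
  apply: measurableT_comp => //; apply: measurableT_comp => //.
  exact: (adapted_random_process hF aX).
have k0 x : (0 <= (k x)%:E)%E by rewrite lee_fin; case/andP: (k01 x).
have Cneq : (P \x P)%E.-negligible [set w | C w /\ X (sig w) w.1 <> X (sig w) w.2].
  apply: negligibleS (negligibleU sig_max sig_le) => w /= [[Bw sT] /eqP].
  rewrite neq_lt => /orP[h|h]; [left|right]; first by rewrite subr_gt0.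
  by split => //; exact: BX.
have -> : B = C `|` (B `\` C) by rewrite setDUK//; exact: subIsetl.
have disj : [disjoint C & B `\` C] by apply/disj_setPS => w [? []].
have splitE (p : S * S -> S) : measurable_fun setT p ->
    (\int[P \x P]_(w in C `|` (B `\` C)) (k (X T (p w)))%:E =
     \int[P \x P]_(w in C) (k (X T (p w)))%:E +
     \int[P \x P]_(w in B `\` C) (k (X T (p w)))%:E)%E.
  by move=> mp; apply: ge0_integral_setU => //; exact: mkX.
rewrite (splitE fst)// (splitE snd)//.
rewrite (terminal_law ck k01 hsig sig_T hC Cneq); apply: leeD2l.
apply: ae_ge0_le_integral => //.
- by apply: mkX; exact: measurable_fst.
- by apply: mkX; exact: measurable_snd.
- apply: negligibleS sig_le => w /= /not_implyP[[Bw nC] h].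
  split; first exact: BX.
  have sT : sig w = T.
    apply/eqP; rewrite eq_le sig_T leNgt; apply/negP => sT; exact: nC.
  rewrite sT ltNge; apply/negP => h'; apply: h; rewrite lee_fin; exact: hk.
Qed.

End Comparison.

(** * From continuous functions to monotone functions *)

Section StochasticOrder.
Context {R : realType} d (S : measurableType d) (P : probability S R).

(** Both integrals are integrals of tails with respect to the Lebesgue measure. *)
Lemma le_integral_of_tails (B : set S) (h1 h2 : S -> R) : measurable B ->
  measurable_fun setT h1 -> measurable_fun setT h2 ->
  (forall w, 0 <= h1 w) -> (forall w, 0 <= h2 w) ->
  (forall r, (P (B `&` [set w | (r < h1 w)%R]) <= P (B `&` [set w | (r < h2 w)%R]))%E) ->
  (\int[P]_(w in B) (h1 w)%:E <= \int[P]_(w in B) (h2 w)%:E)%E.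
Proof.
move=> mB mh1 mh2 h10 h20 h12.
have mh h : measurable_fun setT h -> measurable_fun setT (h \_ B : S -> R).
  by move=> mh; apply/(measurable_restrictT h mB); exact: measurable_funTS.
have ccdfE (h : S -> R) (X : {RV P >-> R}) r : X = h \_ B :> (S -> R) ->
    0 <= r -> ccdf X r = P (B `&` [set w | (r < h w)%R]).
  move=> XE r0; rewrite /ccdf /distribution /pushforward; congr (P _).
  apply/seteqP; split => w /=; rewrite in_itv/= andbT XE patchE.
    case: ifP => [/set_mem//|_ /=]; by rewrite ltNge r0.
  by move=> [/mem_set -> ?].
have tailE (h : S -> R) (X : {RV P >-> R}) : X = h \_ B :> (S -> R) ->
    (forall w, 0 <= h w) ->
    (\int[P]_(w in B) (h w)%:E)%E =
    (\int[lebesgue_measure]_(r in `[0%R, +oo[) ccdf X r)%E.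
  move=> XE h0; rewrite -ge0_expectation_ccdf; last first.
    by move=> w; rewrite XE patchE; case: ifP.
  rewrite expectation_def integral_mkcond; apply: eq_integral => w _.
  by rewrite XE !patchE; case: ifP.
pose X1 : {RV P >-> R} := mfun_Sub (mem_set (mh _ mh1) : h1 \_ B \in mfun).
pose X2 : {RV P >-> R} := mfun_Sub (mem_set (mh _ mh2) : h2 \_ B \in mfun).
rewrite (tailE h1 X1)// (tailE h2 X2)//.
apply: ge0_le_integral => //.
- by apply: measurable_funTS; exact: ccdf_measurable.
- by apply: measurable_funTS; exact: ccdf_measurable.
- move=> r /=; rewrite in_itv/= andbT => r0.
  by rewrite (ccdfE h1 X1)// (ccdfE h2 X2).
Qed.

End StochasticOrder.

Section UpSets.
Context {R : realType}.

Lemma upset_measurable (U : set R) : (forall x y, x <= y -> U x -> U y) ->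
  measurable U.
Proof.
move=> upU; apply: is_interval_measurable => x y Ux _ z /andP[xz _].
exact: upU xz Ux.
Qed.

Lemma upset_continuous_approx (U : set R) :
  (forall x y, x <= y -> U x -> U y) ->
  exists k : nat -> R -> R, [/\ forall n, continuous (k n),
    forall n x, 0 <= k n x <= 1, forall n, {homo k n : x y / x <= y} &
    forall x, k n x @[n --> \oo] --> (\1_U x : R)].
Proof.
move=> upU; have [->|/set0P[u Uu]] := eqVneq U set0.
  exists (fun _ _ => 0); split => //.
  - by move=> n; exact: cst_continuous.
  - by move=> n x; rewrite lexx ler01.
  - by move=> n x y _; exact: lexx.
  - by move=> x; rewrite indicE memNset//; exact: cvg_cst.
have [[l lU]|nlb] := pselect (has_lbound U); last first.
  have UT x : U x.
    apply: contrapT => Ux; apply: nlb; exists x => y Uy.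
    by rewrite leNgt; apply/negP => yx; apply: Ux; exact: upU (ltW yx) Uy.
  exists (fun _ _ => 1); split => //.
  - by move=> n; exact: cst_continuous.
  - by move=> n x; rewrite lexx ler01.
  - by move=> n x y _; exact: lexx.
  - by move=> x; rewrite indicE mem_set//; exact: cvg_cst.
(* The ramps below increase from 0 to 1 within distance [1 / n] of [a = inf U], on
   the left of [a] if [a] belongs to [U] and on its right otherwise. *)
have hinf : has_inf U by split; [exists u|exists l].
pose a := inf U; pose c : R := \1_U a.
have Ua x : a < x -> U x.
  by move=> ax; have [y Uy yx] := inf_lt hinf.1 ax; exact: upU (ltW yx) Uy.
have nUa x : x < a -> ~ U x.
  by move=> xa Ux; have := ge_inf hinf.2 Ux; rewrite leNgt xa.
pose k n x : R := Num.min 1 (Num.max 0 (c + n%:R * (x - a))).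
exists k; split.
- move=> n x.
  change {for x, continuous ((cst 1) \min ((cst 0) \max (fun y => c + n%:R * (y - a))))}.
  apply: continuous_min; first exact: cst_continuous.
  apply: continuous_max; first exact: cst_continuous.
  apply: cvgD; first exact: cvg_cst.
  by apply: cvgM; [exact: cvg_cst|apply: cvgB; [exact: cvg_id|exact: cvg_cst]].
- move=> n x; rewrite /k ge_min lexx/= andbT le_min ler01/=.
  by rewrite le_max lexx.
- move=> n x y xy; rewrite /k; apply: le_min2 => //; apply: le_max2 => //.
  by rewrite lerD2l ler_wpM2l// lerD2r.
- move=> x; have c01 : 0 <= c <= 1 by rewrite /c indicE; case: (_ \in _); rewrite ?lexx ?ler01.
  have /andP[c0 c1] := c01.
  have cvg_near (s : R) : (\forall n \near \oo, k n x = s) -> k n x @[n --> \oo] --> s.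
    move=> h; apply: cvg_near_cst; exact: h.
  have big (e : R) : 0 < e -> \forall n \near \oo, 1 <= n%:R * e.
    move=> e0; near=> n; rewrite -ler_pdivrMr// mul1r.
    near: n; exact: nbhs_infty_ger.
  have [xa|ax|xa] := ltgtP x a.
  - rewrite indicE memNset; last exact: nUa.
    apply: cvg_near; have : 0 < a - x by rewrite subr_gt0.
    move=> /big; apply: filterS => n hn; rewrite /k.
    have -> : Num.max 0 (c + n%:R * (x - a)) = 0.
      apply/max_idPl; rewrite -opprB mulrN subr_le0; exact: le_trans c1 hn.
    by apply/min_idPr.
  - rewrite indicE mem_set; last exact: Ua.
    apply: cvg_near; have : 0 < x - a by rewrite subr_gt0.
    move=> /big; apply: filterS => n hn; rewrite /k; apply/min_idPl.
    rewrite le_max; apply/orP; right; apply: le_trans hn _; by rewrite lerDr.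
  - apply: cvg_near; apply: nearW => n; rewrite /k xa subrr mulr0 addr0 -/c.
    by rewrite (max_idPr _)// (min_idPr _).
Unshelve. all: by end_near. Qed.

End UpSets.

Section CoupledComparison.
Context {R : realType} d (S : measurableType d) (P : probability S R).
Variables (F : R -> set (set S)) (X : R -> S -> R).
Hypotheses (hF : filtration F) (aX : adapted F X) (smX : strong_markov P F X)
  (acX : almost_continuous P X).
Local Notation G := (section_filtration F).
Variables (t T : R) (B : set (S * S)).
Hypotheses (t0 : 0 <= t) (tT : t <= T) (GB : G t B)
  (BX : B `<=` [set w | X t w.1 < X t w.2]).

Let T0 : 0 <= T. Proof. exact: le_trans tT. Qed.
Let mB : measurable B. Proof. by case: GB. Qed.

Let mX (p : S * S -> S) : measurable_fun setT p ->
  measurable_fun setT (fun w => X T (p w)).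
Proof.
move=> mp; apply: measurableT_comp => //.
exact: (adapted_random_process hF aX).
Qed.

Let m1 := @measurable_fst _ _ S S.
Let m2 := @measurable_snd _ _ S S.

Lemma coupled_comparison_upset (U : set R) : (forall x y, x <= y -> U x -> U y) ->
  ((P \x P) (B `&` [set w | U (X T w.1)]) <=
   (P \x P) (B `&` [set w | U (X T w.2)]))%E.
Proof.
move=> upU; have [k [ck k01 hk kU]] := upset_continuous_approx upU.
have mU := upset_measurable upU.
have cvgk (p : S * S -> S) : measurable_fun setT p ->
    (\int[P \x P]_(w in B) (k n (X T (p w)))%:E)%E @[n --> \oo] -->
    (P \x P)%E (B `&` [set w | U (X T (p w))]).
  move=> mp; have mXU : measurable [set w | U (X T (p w))].
    by rewrite -[X in measurable X]setTI; apply: (mX mp).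
  rewrite setIC -(integral_indic (P \x P)%E mB mXU).
  apply: (@dominated_cvg _ _ _ _ B mB _ _ (cst 1%E)) => //.
  - move=> n; apply: measurable_funTS; apply/measurable_EFinP.
    apply: measurableT_comp (mX mp).
    exact: continuous_measurable_fun.
  - move=> w _; apply: cvg_EFin; first by near=> n.
    exact: kU.
  - exact: (@finite_measure_integrable_cst _ _ R ((P \x P)%E : probability _ R) B 1 mB).
  - move=> n w _; have /andP[k0 k1] := k01 n (X T (p w)).
    by rewrite /= lee_fin ger0_norm.
have c1 := cvgk _ m1; have c2 := cvgk _ m2.
rewrite -(cvg_lim _ c1)// -(cvg_lim _ c2)//; apply: lee_lim.
- by apply/cvg_ex; eexists; exact: c1.
- by apply/cvg_ex; eexists; exact: c2.
- near=> n; exact: (coupled_comparison_continuous hF aX smX acX (ck n) (k01 n) (hk n) t0 tT GB BX).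
Unshelve. all: by end_near. Qed.

Lemma coupled_comparison_nondecreasing (g : R -> R) :
  {homo g : x y / x <= y} -> (forall x, 0 <= g x) ->
  (\int[P \x P]_(w in B) (g (X T w.1))%:E <=
   \int[P \x P]_(w in B) (g (X T w.2))%:E)%E.
Proof.
move=> hg g0; have mg : measurable_fun setT g.
  by apply: nondecreasing_measurable => // x y xy; exact: hg.
apply: (@le_integral_of_tails _ _ _ ((P \x P)%E : probability _ R)) => //.
- exact: measurableT_comp mg (mX m1).
- exact: measurableT_comp mg (mX m2).
- move=> r; apply: (@coupled_comparison_upset [set x | r < g x]) => x y xy /= rx.
  exact: lt_le_trans (hg _ _ xy).
Qed.

(** The tails are now complements of up-sets, which reverses the comparison. *)
Lemma coupled_comparison_nonincreasing (g : R -> R) :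
  {homo g : x y / x <= y >-> y <= x} -> (forall x, 0 <= g x) ->
  (\int[P \x P]_(w in B) (g (X T w.2))%:E <=
   \int[P \x P]_(w in B) (g (X T w.1))%:E)%E.
Proof.
move=> hg g0; have mg : measurable_fun setT g.
  apply: nonincreasing_measurable => // x y xy; exact: hg.
apply: (@le_integral_of_tails _ _ _ ((P \x P)%E : probability _ R)) => //.
- exact: measurableT_comp mg (mX m2).
- exact: measurableT_comp mg (mX m1).
- move=> r; pose U := [set x | g x <= r].
  have upU x y : x <= y -> U x -> U y by move=> xy; exact: le_trans (hg _ _ xy).
  have tailE (p : S * S -> S) : measurable_fun setT p ->
      ((P \x P) (B `&` [set w | (r < g (X T (p w)))%R]) =
       (P \x P) B - (P \x P) (B `&` [set w | U (X T (p w))]))%E.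
    move=> mp; rewrite -measureD//.
    - congr ((P \x P)%E _); apply/seteqP; split => w /= [Bw].
        by move=> h; split => //; apply/negP; rewrite -ltNge.
      by move=> /negP; rewrite -ltNge.
    - rewrite -[X in measurable X]setTI; apply: (mX mp) => //.
      exact: upset_measurable.
    - apply: le_lt_trans (ltry 1).
      exact: (probability_le1 ((P \x P)%E : probability _ R) mB).
  have := leeB (lexx ((P \x P)%E B)) (coupled_comparison_upset upU).
  by rewrite -(tailE fst m1) -(tailE snd m2).
Qed.

End CoupledComparison.

(** * The increasing version *)

Section MonotoneVersion.
Context {R : realType} d (S : measurableType d) (P : probability S R).
Variables (Z : S -> R) (phi : R -> R).
Hypotheses (mZ : measurable_fun setT Z) (mphi : measurable_fun setT phi).
Hypothesis no_inversion : (P \x P)%E.-negligible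
  [set w : S * S | Z w.1 < Z w.2 /\ phi (Z w.2) < phi (Z w.1)].

Let mphiZ : measurable_fun setT (phi \o Z). Proof. exact: measurableT_comp. Qed.

Let A c : set S := [set w | c < phi (Z w)].

Let mA c : measurable (A c).
Proof.
rewrite (_ : A c = (phi \o Z) @^-1` `]c, +oo[).
  by rewrite -[X in measurable X]setTI; exact: mphiZ.
by apply/seteqP; split => w /=; rewrite in_itv/= andbT.
Qed.

Let L x : set S := [set w | Z w <= x].

Let mL x : measurable (L x).
Proof.
rewrite (_ : L x = Z @^-1` `]-oo, x]).
  by rewrite -[X in measurable X]setTI; exact: mZ.
by apply/seteqP; split => w /=; rewrite in_itv.
Qed.

Let mAL c x : measurable (A c `&` L x). Proof. exact: measurableI. Qed.

(** The essential supremum of [phi] over the values of [Z] that are at most [x]. *)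
Definition increasing_version (x : R) : \bar R :=
  ereal_sup [set c%:E | c in [set c | (0 < P (A c `&` L x))%E]].

Lemma increasing_version_homo :
  {homo increasing_version : x y / x <= y >-> (x <= y)%E}.
Proof.
move=> x y xy; apply: ereal_sup_le => _ [c /= c0 <-]; exists c => //=; apply: lt_le_trans c0 _; apply: le_measure; rewrite ?inE//.
by apply: setIS => w /= Zx; exact: le_trans xy.
Qed.

(** By Tonelli's theorem, almost every [Z w] has almost no point on its left where
[phi] is larger. *)
Let ae_le : {ae P, forall w, (increasing_version (Z w) <= (phi (Z w))%:E)%E}.
Proof.
pose I := [set w : S * S | Z w.1 < Z w.2 /\ phi (Z w.2) < phi (Z w.1)].
have mI : measurable I.
  have m1 := measurableT_comp mZ (@measurable_fst _ _ S S).
  have m2 := measurableT_comp mZ (@measurable_snd _ _ S S).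
  have p1 := measurableT_comp mphiZ (@measurable_fst _ _ S S).
  have p2 := measurableT_comp mphiZ (@measurable_snd _ _ S S).
  rewrite (_ : I = [set w | Z w.1 < Z w.2] `&` [set w | phi (Z w.2) < phi (Z w.1)])//.
  by apply: measurableI; exact: measurable_ltset.
have sI y : [set x | I (x, y)] = ysection I y.
  by apply/seteqP; split => x /=; rewrite /ysection/= inE.
have PI : (\int[P]_y P (ysection I y))%E = 0%E.
  have <- : (P \x P)%E I = 0%E.
    by apply/(@negligibleP _ _ _ ((P \x P)%E : probability _ R) _ mI).
  have := (@tonelli_sections _ _ _ P I (cst 1%E) mI _ _).1.
  rewrite integral_cst// mul1e => -> //; apply: eq_integral => y _.
  by rewrite sI integral_cst ?mul1e//; exact: measurable_ysection.
have mPI : measurable_fun setT (fun y => P (ysection I y)).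
  exact: measurable_fun_ysection.
have /(ae_eq_integral_abs P measurableT mPI).1 : (\int[P]_y `|P (ysection I y)|)%E = 0%E.
  by rewrite -[RHS]PI; apply: eq_integral => y _; rewrite gee0_abs.
apply: filterS => w /(_ Logic.I)/= Iw; apply: ge_ereal_sup => _ [c /= c0 <-].
rewrite lee_fin leNgt; apply/negP => phic; move: c0; rewrite ltNge => /negP; apply.
rewrite -[leRHS]Iw; apply: le_measure; rewrite ?inE//.
  exact: measurable_ysection.
rewrite -sI => x [/= Ax Lx]; have phix : phi (Z w) < phi (Z x) by exact: lt_trans Ax.
split => //=; rewrite lt_neqAle; rewrite Lx andbT; apply/eqP => ZE.
by rewrite ZE ltxx in phix.
Qed.

(** The points [x] at which an initial segment [A c `&` L x] is null form a
down-set, which is exhausted by the rational ones among them and possibly one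
largest point; so the union of these initial segments is null. *)
Let ae_gt c : {ae P, forall w, c < phi (Z w) -> (0 < P (A c `&` L (Z w)))%E}.
Proof.
pose N := [set w | A c w /\ P (A c `&` L (Z w)) = 0%E].
pose M (q : rat) := if P (A c `&` L (ratr q)) == 0%E then A c `&` L (ratr q) else set0.
have nM n : P.-negligible (if unpickle n is Some q then M q else set0).
  case: unpickle => [q|]; last exact: negligible_set0.
  rewrite /M; case: ifPn => [/eqP Pq|_]; last exact: negligible_set0.
  exact/negligibleP.
have MN q x : P (A c `&` L x) = 0%E -> ratr q <= x -> P (A c `&` L (ratr q)) = 0%E.
  move=> Px qx; apply/eqP; rewrite -measure_le0 -Px; apply: le_measure; rewrite ?inE//.
  by apply: setIS => w /= h; exact: le_trans qx.
have NM w w' : N w -> N w' -> Z w < Z w' -> exists q, M q w.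
  move=> [Aw _] [_ Pw'] /rat_in_itvoo[q]; rewrite in_itv/= => /andP[wq qw'].
  by exists q; rewrite /M (MN _ _ Pw' (ltW qw')) eqxx; split => //; exact: ltW.
pose M' := \bigcup_n (if unpickle n is Some q then M q else set0).
have nM' : P.-negligible M' by exact: negligible_bigcup.
have inM' q w : M q w -> M' w.
  by move=> Mq; exists (pickle q); [exact: Logic.I|rewrite pickleK].
suff : P.-negligible N.
  apply: negligibleS => w /= /not_implyP[cw h]; split => //.
  by apply/eqP; rewrite -measure_le0 leNgt; apply/negP.
have [[w0 [Nw0 M'w0]]|allM'] := pselect (exists w0, N w0 /\ ~ M' w0); last first.
  apply: negligibleS nM' => w Nw; apply: contrapT => nMw.
  by apply: allM'; exists w.
have n0 : P.-negligible (A c `&` L (Z w0)) by apply/negligibleP => //; case: Nw0.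
apply: negligibleS (negligibleU nM' n0) => w Nw.
have [w0w|ww0] := ltP (Z w0) (Z w); last by right; split => //; case: Nw.
by have [q /inM'] := NM _ _ Nw0 Nw w0w.
Qed.

(** One inequality is the absence of inversions; the other one says that the
essential supremum up to [Z w] takes [phi (Z w)] itself into account, which holds
for every level [c] by [ae_gt]. *)
Lemma increasing_version_ae :
  {ae P, forall w, increasing_version (Z w) = (phi (Z w))%:E}.
Proof.
have : {ae P, forall w n, if unpickle n is Some q then
    ratr q < phi (Z w) -> (0 < P (A (ratr q) `&` L (Z w)))%E else True}.
  apply: ae_foralln => n; case: unpickle => [q|]; first exact: ae_gt.
  by apply: aeW.
move: ae_le; apply: filterS2 => w le1 gt1; apply/eqP; rewrite eq_le le1/=.
apply/lee_subgt0Pr => e e0; have : phi (Z w) - e < phi (Z w) by rewrite ltrBlDr ltrDl.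
move=> /rat_in_itvoo[q]; rewrite in_itv/= => /andP[eq qphi].
apply: le_trans (_ : (ratr q)%:E <= _)%E; first by rewrite lee_fin ltW.
apply: ereal_sup_ubound; exists (ratr q) => //=.
by have := gt1 (pickle q); rewrite pickleK; exact.
Qed.

End MonotoneVersion.

(** * The Markov property for integrable functions *)

Section IntegrableMarkov.
Context {R : realType} d (S : measurableType d) (P : probability S R).
Variables (F : R -> set (set S)) (X : R -> S -> R).
Hypotheses (hF : filtration F) (aX : adapted F X) (smX : strong_markov P F X)
  (cX : cadlag X).
Variables (t T : R).
Hypotheses (t0 : 0 <= t) (tT : t <= T).

(** The function [h] is cut into the bounded pieces where its integer part is
[n], to which the strong Markov property applies, and the resulting functions are
summed. *)
Lemma markov_integrable_ge0 (h : R -> R) : measurable_fun setT h ->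
  (forall x, 0 <= h x) -> (\int[P]_w (h (X T w))%:E < +oo)%E ->
  exists phi : R -> R, [/\ measurable_fun setT phi, forall x, 0 <= phi x &
    forall A, F t A ->
      (\int[P]_(w in A) (phi (X t w))%:E = \int[P]_(w in A) (h (X T w))%:E)%E].
Proof.
move=> mh h0 hoo; have T0 := le_trans t0 tT.
have mX s : 0 <= s -> measurable_fun setT (X s) by exact: (adapted_random_process hF aX).
pose hn (n : nat) (x : R) : R := if (n%:R <= h x < n.+1%:R) then h x else 0.
have hn0 n x : 0 <= hn n x by rewrite /hn; case: ifP.
have mhn n : measurable_fun setT (hn n).
  apply: measurable_fun_ifT => //.
  apply: measurable_and; [exact: measurable_fun_ler|exact: measurable_fun_ltr].
have bhn n : bounded_fun (hn n).
  exists n.+1%:R; split => // M nM x _ /=.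
  rewrite ger0_norm// (le_trans _ (ltW nM))// /hn; case: ifP => // /andP[_].
  exact: ltW.
have hnE x : (\sum_(0 <= n <oo) (hn n x)%:E)%E = (h x)%:E.
  rewrite (@nneseriesD1 _ _ (Num.truncn (h x)))//.
    rewrite eseries0 ?adde0 => [|i _ /= iN].
      by rewrite /hn truncn_itv.
    rewrite /hn; case: ifP => // /truncn_def nE.
    by rewrite nE eqxx in iN.
  by move=> k _; rewrite lee_fin.
have u0 : 0 <= T - t by rewrite subr_ge0.
have /choice[fn hfn] n := strong_markov_ge0 hF aX smX cX (mhn n) (bhn n) (hn0 n) u0.
pose phin n x := fn n (t, x).
have phin0 n x : 0 <= phin n x by have [_ + _] := hfn n; exact.
have mphin n : measurable_fun setT (phin n).
  have [mf _ _] := hfn n.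
  exact: (measurable_halfplane_comp (tau := fun=> t) (Z := id) mf).
have phinE n A : F t A ->
    (\int[P]_(w in A) (phin n (X t w))%:E = \int[P]_(w in A) (hn n (X T w))%:E)%E.
  move=> FA; have [_ _ /(_ _ (cst_stopping_time hF t0) A)] := hfn n.
  rewrite addrC subrK => <- //.
  exact: (stopped_sigma_ge hF (cst_stopping_time hF t0) t0).
pose psi x := (\sum_(0 <= n <oo) (phin n x)%:E)%E.
have psi0 x : (0 <= psi x)%E by apply: nneseries_ge0 => n _ _; rewrite lee_fin.
have mpsi : measurable_fun setT psi.
  apply: ge0_emeasurable_sum => [k x _ _|k _]; first by rewrite lee_fin.
  exact/measurable_EFinP.
have psiE A : F t A ->
    (\int[P]_(w in A) psi (X t w) = \int[P]_(w in A) (h (X T w))%:E)%E.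
  move=> FA; have mA := filtration_measurable hF t0 FA.
  under [RHS]eq_integral do rewrite -hnE.
  rewrite !integral_nneseries//.
  - by apply: eq_eseriesr => n _; exact: phinE.
  - move=> n; apply: measurable_funTS; apply/measurable_EFinP.
    exact: (measurableT_comp (mphin n) (mX _ t0)).
  - by move=> n x _; rewrite lee_fin.
  - move=> n; apply: measurable_funTS; apply/measurable_EFinP.
    exact: (measurableT_comp (mhn n) (mX _ T0)).
  - by move=> n x _; rewrite lee_fin.
have sF := filtration_sigma hF t0.
have mpsiX : measurable_fun setT (fun w => psi (X t w)).
  exact: measurableT_comp mpsi (mX _ t0).
have ipsi : P.-integrable setT (fun w => psi (X t w)).
  apply/integrableP; split => //.
  under eq_integral do rewrite gee0_abs//.
  rewrite psiE//; exact: sigma_algebra_setT.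
have mphi : measurable_fun setT (fine \o psi) by exact: measurableT_comp.
exists (fine \o psi); split => //.
- by move=> x; exact: fine_ge0.
- move=> A FA; have mA := filtration_measurable hF t0 FA.
  rewrite -psiE//; apply: ae_eq_integral => //.
  + apply: measurable_funTS; apply/measurable_EFinP.
    exact: (measurableT_comp mphi (mX _ t0)).
  + exact: measurable_funTS.
  + have := integrable_ae measurableT ipsi.
    by apply: filterS => w h' _ /=; rewrite fineK//; exact: h'.
Qed.

End IntegrableMarkov.

(** * Absence of inversions *)

Section Main.
Context {R : realType} d (S : measurableType d) (P : probability S R).
Variables (F : R -> set (set S)) (X : R -> S -> R).
Hypotheses (hF : filtration F) (aX : adapted F X) (smX : strong_markov P F X)
  (acX : almost_continuous P X).
Local Notation G := (section_filtration F).
Variables (t T : R).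
Hypotheses (t0 : 0 <= t) (tT : t <= T).

Let T0 : 0 <= T. Proof. exact: le_trans tT. Qed.
Let mX s : 0 <= s -> measurable_fun setT (X s).
Proof. exact: (adapted_random_process hF aX). Qed.

Lemma product_cond_exp (f h : R -> R) (B : set (S * S)) : G t B ->
  measurable_fun setT f -> measurable_fun setT h ->
  (forall x, 0 <= f x) -> (forall x, 0 <= h x) ->
  (forall A, F t A ->
    \int[P]_(w in A) (f (X t w))%:E = \int[P]_(w in A) (h (X T w))%:E)%E ->
  (\int[P \x P]_(w in B) (f (X t w.1))%:E =
     \int[P \x P]_(w in B) (h (X T w.1))%:E)%E /\
  (\int[P \x P]_(w in B) (f (X t w.2))%:E =
     \int[P \x P]_(w in B) (h (X T w.2))%:E)%E.
Proof.
move=> [mB B1 B2] mf mh f0 h0 fh.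
have mfX s (k : R -> R) (p : S * S -> S) : 0 <= s -> measurable_fun setT k ->
    measurable_fun setT p -> measurable_fun setT (fun w => (k (X s (p w)))%:E).
  move=> s0 mk mp; apply/measurable_EFinP.
  exact: (measurableT_comp mk (measurableT_comp (mX s0) mp)).
have m1 := @measurable_fst _ _ S S; have m2 := @measurable_snd _ _ S S.
split.
  rewrite (tonelli_sections P mB (mfX _ _ _ t0 mf m1) _).1; last first.
    by move=> w; rewrite lee_fin.
  rewrite (tonelli_sections P mB (mfX _ _ _ T0 mh m1) _).1; last first.
    by move=> w; rewrite lee_fin.
  by apply: eq_integral => y _ /=; exact: fh.
rewrite (tonelli_sections P mB (mfX _ _ _ t0 mf m2) _).2; last first.
  by move=> w; rewrite lee_fin.
rewrite (tonelli_sections P mB (mfX _ _ _ T0 mh m2) _).2; last first.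
  by move=> w; rewrite lee_fin.
by apply: eq_integral => y _ /=; exact: fh.
Qed.

Lemma product_marginal_lty (f : S -> R) (B : set (S * S)) : measurable B ->
  measurable_fun setT f -> (forall x, 0 <= f x) ->
  (\int[P]_x (f x)%:E < +oo)%E ->
  (\int[P \x P]_(w in B) (f w.1)%:E < +oo)%E /\
  (\int[P \x P]_(w in B) (f w.2)%:E < +oo)%E.
Proof.
move=> mB mf f0 foo.
have mfE (p : S * S -> S) : measurable_fun setT p ->
    measurable_fun setT (fun w => (f (p w))%:E).
  by move=> mp; apply/measurable_EFinP; exact: measurableT_comp mp.
have m1 := @measurable_fst _ _ S S; have m2 := @measurable_snd _ _ S S.
have full (p : S * S -> S) : measurable_fun setT p ->
    (\int[P \x P]_(w in B) (f (p w))%:E <= \int[P \x P]_(w in setT) (f (p w))%:E)%E.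
  move=> mp; apply: ge0_subset_integral => //; first exact: mfE.
  by move=> w _; rewrite lee_fin.
have oneK : (\int[P]_(y in [set: S]) (\int[P]_x (f x)%:E) < +oo)%E.
  by rewrite integral_cst//= probability_setT mule1.
split.
  apply: le_lt_trans (full _ m1) _.
  rewrite (tonelli_sections P measurableT (mfE _ m1) _).1//.
  by move=> w; rewrite lee_fin.
apply: le_lt_trans (full _ m2) _.
rewrite (tonelli_sections P measurableT (mfE _ m2) _).2//.
by move=> w; rewrite lee_fin.
Qed.

Variable (g : R -> R).
Hypothesis (hg : {homo g : x y / x <= y}).

Let gp x := Num.max (g x) 0.
Let gm x := Num.max (- g x) 0.

Let g_gpm x : g x = gp x - gm x.
Proof.
rewrite /gp /gm; have [g0|g0] := leP 0 (g x).
  by rewrite (max_idPr _) ?oppr_le0// subr0.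
by rewrite (max_idPl _) ?oppr_ge0 ?ltW// sub0r opprK.
Qed.

Let mg : measurable_fun setT g.
Proof. by apply: nondecreasing_measurable => // x y xy; exact: hg. Qed.

Let mgp : measurable_fun setT gp. Proof. exact: measurable_maxr. Qed.

Let mgm : measurable_fun setT gm.
Proof. by apply: measurable_maxr => //; exact: measurableT_comp. Qed.

Let gp0 x : 0 <= gp x. Proof. by rewrite le_max lexx orbT. Qed.
Let gm0 x : 0 <= gm x. Proof. by rewrite le_max lexx orbT. Qed.

Section Versions.
Variables (pp pm : R -> R).
Hypotheses (mpp : measurable_fun setT pp) (mpm : measurable_fun setT pm)
  (pp0 : forall x, 0 <= pp x) (pm0 : forall x, 0 <= pm x).
Hypotheses
  (ppE : forall A, F t A ->
    (\int[P]_(w in A) (pp (X t w))%:E = \int[P]_(w in A) (gp (X T w))%:E)%E)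
  (pmE : forall A, F t A ->
    (\int[P]_(w in A) (pm (X t w))%:E = \int[P]_(w in A) (gm (X T w))%:E)%E).
Hypotheses (gp_lty : (\int[P]_w (gp (X T w))%:E < +oo)%E)
  (gm_lty : (\int[P]_w (gm (X T w))%:E < +oo)%E).

Let FT : F t setT.
Proof. exact: (sigma_algebra_setT (filtration_sigma hF t0)). Qed.

Let pp_lty : (\int[P]_w (pp (X t w))%:E < +oo)%E. Proof. by rewrite ppE. Qed.
Let pm_lty : (\int[P]_w (pm (X t w))%:E < +oo)%E. Proof. by rewrite pmE. Qed.

Let phi x := pp x - pm x.

Let mphi : measurable_fun setT phi. Proof. exact: measurable_funB. Qed.

Lemma cond_exp_version_sub :
  cond_exp_version P (F t) (fun w => g (X T w)) (fun w => phi (X t w)).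
Proof.
have int_of (k : R -> R) s : 0 <= s -> measurable_fun setT k -> (forall x, 0 <= k x) ->
    (\int[P]_w (k (X s w))%:E < +oo)%E -> P.-integrable setT (EFin \o (k \o X s)).
  move=> s0 mk k0 koo; apply/integrableP; split.
    by apply/measurable_EFinP; exact: (measurableT_comp mk (mX s0)).
  rewrite (eq_integral (fun w => (k (X s w))%:E))// => w _.
  by rewrite /= ger0_norm.
have ipp := int_of _ _ t0 mpp pp0 pp_lty.
have ipm := int_of _ _ t0 mpm pm0 pm_lty.
have igp := int_of _ _ T0 mgp gp0 gp_lty.
have igm := int_of _ _ T0 mgm gm0 gm_lty.
have EB (a b : S -> R) : EFin \o (fun w => a w - b w) =
  (fun w => ((EFin \o a) w - (EFin \o b) w)%E) by apply/funext.
have gE : (fun w => g (X T w)) = (fun w => (gp \o X T) w - (gm \o X T) w).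
  by apply/funext => w; rewrite g_gpm.
split.
- rewrite gE EB; exact: integrableB.
- by move=> B mB; rewrite -[_ @^-1` _]/(X t @^-1` (phi @^-1` B)); apply: aX => //;
    rewrite -[X in measurable X]setTI; exact: mphi.
- rewrite (EB (pp \o X t) (pm \o X t)); exact: integrableB.
- move=> A FA; have mA := filtration_measurable hF t0 FA.
  have sub f : P.-integrable setT f -> P.-integrable A f by exact: integrableS.
  transitivity (\int[P]_(w in A) (pp (X t w))%:E - \int[P]_(w in A) (pm (X t w))%:E)%E.
    rewrite -(integralB mA (sub _ ipp) (sub _ ipm)).
    by apply: eq_integral => w _.
  rewrite ppE// pmE//.
  rewrite -(integralB mA (sub _ igp) (sub _ igm)).
  by apply: eq_integral => w _; rewrite g_gpm.
Qed.

(** The parts [gp] and [gm] of [g] are monotone in opposite directions, so that,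
with [a] and [b] the sums of the functions of the two copies that appear on the
two sides, the comparison at time [T] reads: the integral of [a] over [B] is at
most that of [b].  But [b < a] on [B], hence [B] is null. *)
Lemma inversions_negligible : (P \x P)%E.-negligible
  [set w : S * S | X t w.1 < X t w.2 /\ phi (X t w.2) < phi (X t w.1)].
Proof.
pose B := [set w : S * S | X t w.1 < X t w.2 /\ phi (X t w.2) < phi (X t w.1)].
have GB : G t B.
  pose B' := [set z : R * R | z.1 < z.2 /\ phi z.2 < phi z.1].
  apply: (@section_filtration_adapted _ _ _ _ hF X t B') => //.
  rewrite (_ : B' = [set z | z.1 < z.2] `&` [set z | phi z.2 < phi z.1])//.
  apply: measurableI; apply: measurable_ltset => //.
  - exact: (measurableT_comp mphi (@measurable_snd _ _ R R)).
  - exact: (measurableT_comp mphi (@measurable_fst _ _ R R)).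
have BX : B `<=` [set w | X t w.1 < X t w.2] by move=> w [].
have mB : measurable B by case: GB.
have [p1 p2] := product_cond_exp GB mpp mgp pp0 gp0 ppE.
have [q1 q2] := product_cond_exp GB mpm mgm pm0 gm0 pmE.
have hgp : {homo gp : x y / x <= y} by move=> x y xy; rewrite le_max2// hg.
have hgm : {homo gm : x y / x <= y >-> y <= x}.
  by move=> x y xy; rewrite le_max2// lerN2 hg.
have le_p := coupled_comparison_nondecreasing hF aX smX acX t0 tT GB BX hgp gp0.
have le_m := coupled_comparison_nonincreasing hF aX smX acX t0 tT GB BX hgm gm0.
rewrite -p1 -p2 in le_p; rewrite -q1 -q2 in le_m.
have [_ p2_lty] := product_marginal_lty mB (measurableT_comp mpp (mX t0)) (fun w => pp0 _) pp_lty.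
have [q1_lty _] := product_marginal_lty mB (measurableT_comp mpm (mX t0)) (fun w => pm0 _) pm_lty.
have mXp s (k : R -> R) (p : S * S -> S) : 0 <= s -> measurable_fun setT k ->
    measurable_fun setT p -> measurable_fun B (fun w => (k (X s (p w)))%:E).
  move=> s0 mk mp; apply: measurable_funTS; apply/measurable_EFinP.
  exact: (measurableT_comp mk (measurableT_comp (mX s0) mp)).
have m1 := @measurable_fst _ _ S S; have m2 := @measurable_snd _ _ S S.
pose a (w : S * S) := ((pp (X t w.1))%:E + (pm (X t w.2))%:E)%E.
pose b (w : S * S) := ((pp (X t w.2))%:E + (pm (X t w.1))%:E)%E.
pose c (w : S * S) : \bar R := (phi (X t w.1) - phi (X t w.2))%:E.
have mb : measurable_fun B b by apply: emeasurable_funD; exact: mXp.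
have mc : measurable_fun B c.
  apply: measurable_funTS; apply/measurable_EFinP; apply: measurable_funB.
    exact: (measurableT_comp mphi (measurableT_comp (mX t0) m1)).
  exact: (measurableT_comp mphi (measurableT_comp (mX t0) m2)).
have c0 w : B w -> (0 < c w)%E by move=> [_ h]; rewrite lte_fin subr_gt0.
have acb w : a w = (b w + c w)%E.
  rewrite /a /b /c /phi -!EFinD; congr (_%:E).
  by ring.
have int_ab : (\int[P \x P]_(w in B) a w <= \int[P \x P]_(w in B) b w)%E.
  rewrite !ge0_integralD//; last 8 first.
  all: try (by move=> w _; rewrite lee_fin).
  all: try exact: mXp.
  exact: leeD.
have b_fin : (\int[P \x P]_(w in B) b w)%E \is a fin_num.
  rewrite ge0_fin_numE; last by apply: integral_ge0 => w _; rewrite adde_ge0// lee_fin.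
  rewrite ge0_integralD//; last 4 first.
  all: try (by move=> w _; rewrite lee_fin).
  all: try exact: mXp.
  exact: lte_add_pinfty.
have int_c : (\int[P \x P]_(w in B) c w)%E = 0%E.
  apply/eqP; rewrite eq_le; apply/andP; split; last first.
    by apply: integral_ge0 => w /c0/ltW.
  move: int_ab; under eq_integral do rewrite acb.
  rewrite ge0_integralD//; last 2 first.
  - by move=> w _; rewrite adde_ge0// lee_fin.
  - by move=> w /c0/ltW.
  by rewrite -[X in (_ <= X)%E -> _]adde0 leeD2lE.
have /(ae_eq_integral_abs _ mB mc).1 : (\int[P \x P]_(w in B) `|c w|)%E = 0%E.
  rewrite -[RHS]int_c; apply: eq_integral => w /set_mem/c0/ltW c0'.
  by rewrite gee0_abs.
apply: negligibleS => w Bw /= h; have := c0 w Bw.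
by rewrite (h Bw) ltxx.
Qed.

End Versions.

Hypothesis hint : (\int[P]_w (`|g (X T w)|)%:E < +oo)%E.

Let dominated_lty (k : R -> R) : measurable_fun setT k -> (forall x, 0 <= k x) ->
  (forall x, k x <= `|g x|) -> (\int[P]_w (k (X T w))%:E < +oo)%E.
Proof.
move=> mk k0 kg; apply: le_lt_trans hint; apply: ge0_le_integral => //.
- by move=> w _; rewrite lee_fin.
- by apply/measurable_EFinP; exact: (measurableT_comp mk (mX T0)).
- apply/measurable_EFinP; apply: measurableT_comp => //.
  exact: (measurableT_comp mg (mX T0)).
- by move=> w _; rewrite lee_fin.
Qed.

Lemma exists_uninverted_cond_exp : exists phi : R -> R,
  [/\ measurable_fun setT phi,
    cond_exp_version P (F t) (fun w => g (X T w)) (fun w => phi (X t w)) &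
    (P \x P)%E.-negligible
      [set w : S * S | X t w.1 < X t w.2 /\ phi (X t w.2) < phi (X t w.1)]].
Proof.
have cX : cadlag X by case: acX.
have gp_lty : (\int[P]_w (gp (X T w))%:E < +oo)%E.
  by apply: dominated_lty => // x; rewrite ge_max ler_norm normr_ge0.
have gm_lty : (\int[P]_w (gm (X T w))%:E < +oo)%E.
  by apply: dominated_lty => // x; rewrite ge_max normr_ge0 andbT -normrN ler_norm.
have [pp [mpp pp0 ppE]] := markov_integrable_ge0 hF aX smX cX t0 tT mgp gp0 gp_lty.
have [pm [mpm pm0 pmE]] := markov_integrable_ge0 hF aX smX cX t0 tT mgm gm0 gm_lty.
exists (fun x => pp x - pm x); split; first exact: measurable_funB.
  exact: cond_exp_version_sub.
exact: inversions_negligible.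
Qed.

End Main.

Theorem theorem1p4 (R : realType) (d : measure_display)
    (Omega : measurableType d) (P : probability Omega R)
    (F : R -> set (set Omega)) (X : R -> Omega -> R)
    (hF : filtration F) (hadapted : adapted F X)
    (hX : almost_continuous_diffusion P F X)
    (g : R -> R) (hg : {homo g : x y / x <= y}) (T : R) (hT : 0 <= T)
    (hint : ('E_P[fun w => `|g (X T w)|%R] < +oo)%E)
    (t : R) (ht0 : 0 <= t) (htT : t <= T) :
  exists f : R -> \bar R,
    {homo f : x y / (x <= y)%R >-> (x <= y)%E} /\
    ae_eq_cond_exp P (F t) (fun w => g (X T w)) (fun w => f (X t w)).
Proof.
have [smX acX] := hX.
have hint' : (\int[P]_w (`|g (X T w)|)%:E < +oo)%E by move: hint; rewrite unlock.
have [phi [mphi phiE noinv]] :=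
  exists_uninverted_cond_exp hF hadapted smX acX ht0 htT hg hint'.
have mXt := adapted_random_process hF hadapted ht0.
exists (increasing_version P (X t) phi); split.
  exact: increasing_version_homo.
exists (fun w => phi (X t w)); split => //.
exact: increasing_version_ae.
Qed.
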